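(* Let $\alpha$ be a countable ordinal and $P$ a poset. The following are equivalent: (i) $P$ is $\alpha\omega$-bqo; (ii) $P$ is $\omega$-bqo and $(S_\omega(P);\leq_{dom})$ is $\alpha$-bqo; (iii) $(\mathfrak{P}_{\leq\omega}(P);\leq_{dom})$ is $\alpha$-bqo; (iv) $(\mathfrak{P}(P);\leq_{dom})$ is $\alpha$-bqo.
   Context: $\alpha\omega$ denotes ordinal multiplication. $\mathfrak{P}(P)$ is the power set of $P$ and $\mathfrak{P}_{\leq\omega}(P)$ the set of countable subsets of $P$. $S_\omega(P)$ is the set of strictly increasing sequences $x_0<x_1<\cdots$ in $P$, each identified with its set of terms. For $X,Y\subseteq P$, $X\leq_{dom}Y$ iff for every $x\in X$ there is $y\in Y$ with $x\leq y$ (a quasi-order). Barriers and $\alpha$-bqo: finite subsets of $\mathbb{N}$ are identified with their increasing enumerations. For finite $s,t\subseteq\mathbb{N}$ write $s\triangleleft t$ if there is a finite $r\subseteq\mathbb{N}$ such that $s$ is a proper initial segment of $r$ and $t$ is $r$ with its least element removed. A barrier is an infinite set $B$ of finite subsets of $\mathbb{N}$, no member of which is a proper subset of another, such that every infinite $X\subseteq\bigcup B$ has a nonempty initial segment belonging to $B$. A barrier is well-ordered by the lexicographic order; its order type is the type of this well-order. A map $f$ from a barrier $B$ into a quasi-ordered set $Q$ is good if there exist $s,t\in B$ with $s\triangleleft t$ and $f(s)\leq f(t)$, and bad otherwise. For a countable ordinal $\beta$, $Q$ is $\beta$-bqo if every map from a barrier of order type at most $\beta$ into $Q$ is good. ($\omega$-bqo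 is equivalent to well-quasi-ordered: well-founded with no infinite antichain.)
   Formalization: The formal theorem assumes that α is infinite (α ≥ ω); for finite α the claim fails: with α = 1 and P an infinite antichain, (iii) and (iv) hold vacuously because barriers are infinite, while (i), that P is ω-bqo, is false. *)

(* Defs.v *)
From mathcomp Require Import all_boot.
Set Implicit Arguments. Unset Strict Implicit. Unset Printing Implicit Defensive.

Definition well_order (T : Type) (lt : T -> T -> Prop) : Prop :=
  [/\ (forall x, ~ lt x x),
      (forall x y z, lt x y -> lt y z -> lt x z),
      (forall x y, x = y \/ lt x y \/ lt y x)
    & well_founded lt].

Definition countable_ordinal (T : Type) (lt : T -> T -> Prop) : Prop :=
  well_order lt /\ exists g : T -> nat, injective g.

Definition omega_lt (m n : nat) : Prop := (m < n)%N.

(** The ordinal product alpha * omega: pairs (n, a) with n in omega, a in alpha,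
    ordered anti-lexicographically (the omega coordinate is compared first). *)
Definition mul_omega_lt (T : Type) (lt : T -> T -> Prop) (p q : nat * T) : Prop :=
  (p.1 < q.1)%N \/ (p.1 = q.1 /\ lt p.2 q.2).

(** Finite subsets of N are identified with strictly increasing sequences. *)

Fixpoint lexlt (s t : seq nat) : bool :=
  match s, t with
  | [::], _ :: _ => true
  | x :: s', y :: t' => (x < y)%N || ((x == y) && lexlt s' t')
  | _, _ => false
  end.

Definition infinite_natset (X : nat -> Prop) : Prop :=
  forall n, exists m, (n <= m)%N /\ X m.

(** [s] (strictly increasing, nonempty) is an initial segment of [X]. *)
Definition init_seg (s : seq nat) (X : nat -> Prop) : Prop :=
  (forall x, x \in s -> X x) /\ (forall x, X x -> (x <= last 0%N s)%N -> x \in s).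

Definition barrier (B : seq nat -> Prop) : Prop :=
  [/\ (forall s, B s -> sorted ltn s),
      ~ (exists l : seq (seq nat), forall s, B s -> s \in l),
      (forall s t, B s -> B t -> {subset s <= t} -> s = t)
    & (forall X : nat -> Prop, infinite_natset X ->
         (forall x, X x -> exists s, B s /\ x \in s) ->
         exists s, [/\ B s, s <> [::] & init_seg s X])].

(** The order type of (B, lexlt) is at most the ordinal represented by
    (T, lt): there is a strictly increasing map from (B, lexlt) to (T, lt). *)
Definition type_le (B : seq nat -> Prop) (T : Type) (lt : T -> T -> Prop) : Prop :=
  exists f : seq nat -> T,
    forall s t, B s -> B t -> lexlt s t -> lt (f s) (f t).

Definition tri (s t : seq nat) : Prop :=
  exists r : seq nat,
    [/\ sorted ltn r, (exists u, u <> [::] /\ r = s ++ u) & t = behead r].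

Definition good (B : seq nat -> Prop) (Q : Type) (le : Q -> Q -> Prop)
  (f : seq nat -> Q) : Prop :=
  exists s t, [/\ B s, B t, tri s t & le (f s) (f t)].

Definition is_bqo (T : Type) (lt : T -> T -> Prop) (Q : Type) (le : Q -> Q -> Prop)
  : Prop :=
  forall B : seq nat -> Prop, barrier B -> type_le B lt ->
    forall f : seq nat -> Q, good B le f.

Definition poset (P : Type) (le : P -> P -> Prop) : Prop :=
  [/\ (forall x, le x x),
      (forall x y, le x y -> le y x -> x = y)
    & (forall x y z, le x y -> le y z -> le x z)].

Definition dom_le (P : Type) (le : P -> P -> Prop) (X Y : P -> Prop) : Prop :=
  forall x, X x -> exists y, Y y /\ le x y.

Definition countable_set (P : Type) (X : P -> Prop) : Prop :=
  exists g : P -> nat, forall x y, X x -> X y -> g x = g y -> x = y.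

Definition countable_subsets (P : Type) : Type := {X : P -> Prop | countable_set X}.
Definition cdom_le (P : Type) (le : P -> P -> Prop) (X Y : countable_subsets P) : Prop :=
  dom_le le (proj1_sig X) (proj1_sig Y).

(** S_omega(P): strictly increasing sequences, identified with their sets
    of terms. *)
Definition strict_incr (P : Type) (le : P -> P -> Prop) (x : nat -> P) : Prop :=
  forall i j, (i < j)%N -> le (x i) (x j) /\ x i <> x j.
Definition S_omega (P : Type) (le : P -> P -> Prop) : Type := {x : nat -> P | strict_incr le x}.
Definition range_of (P : Type) (x : nat -> P) : P -> Prop := fun p => exists i, x i = p.
Definition sdom_le (P : Type) (le : P -> P -> Prop) (x y : S_omega le) : Prop :=
  dom_le le (range_of (proj1_sig x)) (range_of (proj1_sig y)).

(* Main.v *)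
Require Import Defs.
From mathcomp Require Import all_boot boolp zify.
Set Implicit Arguments. Unset Strict Implicit. Unset Printing Implicit Defensive.

(** Suppose [F : B -> P(P)] is bad. Choosing for [s <| t] a point of [F s] not below
    any point of [F t] gives a bad map on the barrier of all [s U t], whose elements
    are the [m :: t]; comparing [m] first bounds its type by alpha * omega.

    Conversely let [f : C -> P] be bad and [h : C -> omega * alpha] strictly increasing.
    One may replace alpha by its largest power omega^b, which embeds in all its own
    tails. Write [c Y] for the segment of [Y] in [C]. By repeated use of the open
    Ramsey theorem there is an infinite set on which:
    - after each finite [s], the values [f (c (s U Y))] are either constant or strictly
      increasing along segments lying far apart (here [P] being wqo is used);
    - for each [n], the segments starting with [n] lie in one copy of omega^b;
    - for each [m] one [n = nu m < m] makes [c (n :: m :: Y)] the longest.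
    The sequences [t] with [nu m :: t] in [C], [m = head t], form a front of type at most
    omega^b (sum over [m] of types below omega^b), and [m :: t] contains a segment of
    [C] for [m < head t]. Cutting it off just before [f] becomes constant yields a
    barrier of type at most alpha on which [s |-> {f (c (s U Y))}], having a strictly
    increasing cofinal sequence, is bad. *)
Local Notation inf := infinite_natset.

(** * Infinite subsets of N and the open Ramsey theorem *)

Definition subs (Y X : nat -> Prop) : Prop := forall x, Y x -> X x.
Definition join (s : seq nat) (Y : nat -> Prop) : nat -> Prop :=
  fun x => x \in s \/ Y x.
Definition above (s : seq nat) (X : nat -> Prop) : nat -> Prop :=
  fun x => X x /\ all (ltn^~ x) s.
Definition agree (n : nat) (Y Z : nat -> Prop) : Prop :=
  forall x, x < n -> (Y x <-> Z x).

Lemma sorted_catP s t : sorted ltn (s ++ t) <->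
  [/\ sorted ltn s, sorted ltn t & forall x y, x \in s -> y \in t -> x < y].
Proof.
rewrite !(sorted_pairwise ltn_trans) pairwise_cat; split.
  by case/and3P=> /allrelP h -> ->.
by case=> -> -> /allrelP ->.
Qed.

Lemma sorted_rconsP s m :
  sorted ltn (rcons s m) <-> sorted ltn s /\ all (ltn^~ m) s.
Proof.
rewrite -cats1; split=> [/sorted_catP[so _ h]|[so /allP h]].
  by split=> //; apply/allP => x xs; apply: h => //; rewrite inE.
by apply/sorted_catP; split=> // x y /h /= lt; rewrite inE => /eqP ->.
Qed.

Lemma setext (Y Z : nat -> Prop) : (forall x, Y x <-> Z x) -> Y = Z.
Proof. by move=> h; apply/funext => x; apply/propext. Qed.

Lemma nat_min (P : nat -> Prop) :
  (exists n, P n) -> exists n, P n /\ forall k, k < n -> ~ P k.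
Proof.
case=> n; elim/ltn_ind: n => n IH Pn.
have [[k [kn Pk]]|h] := EM (exists k, k < n /\ P k); first exact: IH kn Pk.
by exists n; split=> // k kn Pk; apply: h; exists k.
Qed.

Lemma subs_refl X : subs X X. Proof. by []. Qed.

Lemma subs_trans Y X Z : subs X Y -> subs Y Z -> subs X Z.
Proof. by move=> h k x /h /k. Qed.

Lemma above_sub s X : subs (above s X) X. Proof. by move=> x []. Qed.

Lemma above_subs s X Y : subs X Y -> subs (above s X) (above s Y).
Proof. by move=> h x [/h]. Qed.

Lemma above_nil X : above [::] X = X.
Proof. by apply: setext => x; split=> [[]|]. Qed.

Lemma join_nil X : join [::] X = X.
Proof. by apply: setext => x; split=> [[]|]; [| |right]. Qed.

Lemma join_cat s t X : join (s ++ t) X = join s (join t X).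
Proof.
apply: setext => x; rewrite /join mem_cat; split.
  by case=> [/orP[]|] h; [left|right; left|right; right].
by case=> [->|[->|]]; rewrite ?orbT; [left|left|right].
Qed.

Lemma join_rcons s m X : join (rcons s m) X = join s (join [:: m] X).
Proof. by rewrite -cats1 join_cat. Qed.

Lemma join_cons m s X : join (m :: s) X = join [:: m] (join s X).
Proof. by rewrite -join_cat. Qed.

Lemma all_max s n : n < (\max_(i <- s) i).+1 \/ all (ltn^~ n) s.
Proof.
elim: s => [|a s IH] /=; first by right.
rewrite big_cons; set M := \big[_/_]_(_ <- _) _ in IH *.
case: IH => [h|->]; first by left; lia.
by rewrite andbT; case: (ltnP a n) => h; [right|left; lia].
Qed.

Lemma inf_above s X : inf X -> inf (above s X).
Proof.
move=> iX n; have [m [nm Xm]] := iX (maxn n (\max_(i <- s) i).+1).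
exists m; split; first by lia.
by split=> //; case: (all_max s m) => //; lia.
Qed.

Lemma inf_sub X Y : inf X -> subs X Y -> inf Y.
Proof. by move=> iX h n; case: (iX n) => m [nm /h]; exists m. Qed.

Lemma inf_join s X : inf X -> inf (join s X).
Proof. by move=> iX; apply: inf_sub iX _ => x; right. Qed.

Lemma inf_ge n X : inf X -> inf (fun x => X x /\ n <= x).
Proof.
move=> iX k; have [m [km Xm]] := iX (maxn n k).
by exists m; split; [lia | split=> //; lia].
Qed.

Lemma inf_min X : inf X -> exists m, X m /\ forall x, X x -> m <= x.
Proof.
move=> iX; have [|m [Xm h]] := @nat_min X; first by case: (iX 0) => m []; exists m.
by exists m; split=> // x Xx; rewrite leqNgt; apply/negP => /h.
Qed.

Lemma inf_split (X : nat -> Prop) (U : nat -> Prop) : inf X ->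
  exists Y, [/\ inf Y, subs Y X & (forall y, Y y -> U y) \/ (forall y, Y y -> ~ U y)].
Proof.
move=> iX; have [iU|nU] := EM (inf (fun x => X x /\ U x)).
  by exists (fun x => X x /\ U x); split=> // [x []|] //; left=> x [].
have [n hn] : exists n, forall m, n <= m -> X m -> ~ U m.
  apply: contrapT => h; apply: nU => n; apply: contrapT => h'; apply: h.
  by exists n => m nm Xm Um; apply: h'; exists m.
exists (fun x => X x /\ n <= x); split; first exact: inf_ge.
  by move=> x [].
by right=> y [Xy ny]; apply: hn.
Qed.

(** * Diagonalisation over finite sequences *)

Section Diagonal.
Variables (X0 : nat -> Prop).
Implicit Types Phi : seq nat -> (nat -> Prop) -> Prop.

Definition hereditary Phi := forall s X Y, inf Y -> subs Y X -> Phi s X -> Phi s Y.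
Definition dense Phi := forall s X, inf X -> subs X X0 ->
  exists Y, [/\ inf Y, subs Y X & Phi s Y].

Lemma dense_and Phi Psi : hereditary Phi -> dense Phi -> dense Psi ->
  dense (fun s X => Phi s X /\ Psi s X).
Proof.
move=> hP dP dQ s X iX sX; have [Y [iY sY PY]] := dP s X iX sX.
have [Z [iZ sZ QZ]] := dQ s Y iY (subs_trans sY sX).
exists Z; split=> //; first exact: subs_trans sZ sY.
by split=> //; apply: hP PY.
Qed.

Lemma hereditary_and Phi Psi : hereditary Phi -> hereditary Psi ->
  hereditary (fun s X => Phi s X /\ Psi s X).
Proof. by move=> hP hQ s X Y iY sY [/hP P1 /hQ Q1]; split; [exact: P1|exact: Q1]. Qed.

(** Induction on [n]: a sequence below [n.+1] either omits [n] or is some [rcons s n], and the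
    induction hypothesis also applies to [fun s => Phi (rcons s n)]. *)
Lemma dense_below n Phi X : hereditary Phi -> dense Phi -> inf X -> subs X X0 ->
  exists Y, [/\ inf Y, subs Y X &
    forall s, sorted ltn s -> all (ltn^~ n) s -> Phi s Y].
Proof.
elim: n Phi X => [|n IH] Phi X hP dP iX sX.
  have [Y [iY sY PY]] := dP [::] X iX sX.
  by exists Y; split=> // -[|//].
have [Y [iY sY PY]] := IH Phi X hP dP iX sX.
have [|||Z [iZ sZ PZ]] := IH (fun s => Phi (rcons s n)) Y _ _ iY.
- by move=> s; apply: hP.
- by move=> s; apply: dP.
- exact: subs_trans sY sX.
exists Z; split=> //; first exact: subs_trans sZ sY.
move=> s; case/lastP: s => [|s a] so; first by move=> _; apply: hP (PY _ _ _).
rewrite all_rcons => /andP[/= an al].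
have [so' lt_a] := proj1 (sorted_rconsP s a) so.
have [ea|na] := eqVneq a n; last first.
  apply: hP (PY _ _ _) => //; rewrite all_rcons; apply/andP; split=> /=; first lia.
  by apply: sub_all lt_a => x /=; lia.
by rewrite -ea in PZ; apply: PZ.
Qed.

(** A fusion argument: pick [e k] in [W k] and shrink to [W k.+1], where [Phi s] holds for the
    finitely many [s] bounded by [e k]. If [e k] is the last term of [s], all later terms of [e] lie
    in [W k.+1]. *)
Lemma diagonal Phi : inf X0 -> hereditary Phi -> dense Phi ->
  exists X, [/\ inf X, subs X X0 &
    forall s, sorted ltn s -> (forall x, x \in s -> X x) -> Phi s (above s X)].
Proof.
move=> iX0 hP dP.
have step X : exists Y, inf X /\ subs X X0 ->
    exists m, [/\ X m, inf Y, subs Y (above [:: m] X) &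
      forall s, sorted ltn s -> all (ltn^~ m.+1) s -> Phi s Y].
  have [[iX sX]|] := EM (inf X /\ subs X X0); last by exists X.
  have [m [Xm _]] := inf_min iX.
  have [|Y [iY sY PY]] := @dense_below m.+1 Phi (above [:: m] X) hP dP (inf_above _ iX).
    by move=> x [/sX].
  by exists Y => _; exists m.
have [nxt nxtP] := choice step.
(* The empty sequence is treated first, since what follows it is the whole diagonal set, [e 0]
   included. *)
have [Z [iZ sZ PZ]] := dP [::] X0 iX0 (@subs_refl _).
pose W k := iter k nxt Z.
have Wok k : inf (W k) /\ subs (W k) X0.
  elim: k => [//|k [iW sW]]; have [m [_ h1 h2 _]] := nxtP (W k) (conj iW sW).
  by split=> //= x /h2 [/sW].
have /choice [e eP] k : exists m, [/\ W k m, subs (W k.+1) (above [:: m] (W k)) &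
      forall s, sorted ltn s -> all (ltn^~ m.+1) s -> Phi s (W k.+1)].
  by have [m [h1 h2 h3 h4]] := nxtP (W k) (Wok k); exists m.
have Wmono i j : i <= j -> subs (W j) (W i).
  move=> /subnKC <-; elim: (j - i) => [|k IH]; first by rewrite addn0.
  by rewrite addnS => x; case: (eP (i + k)) => _ h _ /h [/IH].
have emono i j : i < j -> e i < e j.
  move=> ij; case: (eP i) => _ h _; case: (eP j) => /(Wmono _ _ ij) /h [_ /=].
  by rewrite andbT.
exists (fun x => exists k, e k = x); split.
- have ge n : n <= e n by elim: n => // n IH; apply: leq_ltn_trans IH (emono _ _ _).
  by move=> n; exists (e n); split=> //; exists n.
- by move=> x [k <-]; case: (eP k) => /(proj2 (Wok k)).
move=> s; case/lastP: s => [|s a] so sX.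
  apply: hP PZ; rewrite ?above_nil.
    by move=> n; exists (e n); split; [elim: n => // n IH; apply: leq_ltn_trans IH (emono _ _ _)|exists n].
  by move=> x [k <-]; case: (eP k) => /(Wmono 0 k (leq0n k)).
have [k ek] : exists k, e k = a by apply: sX; rewrite mem_rcons inE eqxx.
case: (eP k) => _ _ h.
have [so' lt_a] := proj1 (sorted_rconsP s a) so.
apply: hP (h _ so _).
- apply: inf_above => n; exists (e n); split; last by exists n.
  by elim: n => // n IH; apply: leq_ltn_trans IH (emono _ _ _).
- move=> x [[j <-]]; rewrite all_rcons -ek => /andP[hj _].
  have kj : k < j.
    rewrite ltnNge leq_eqVlt; apply/negP => /orP[/eqP ejk|/emono]; move: hj => /=; last lia.
    by rewrite ejk; lia.
  by case: (eP j) => /(Wmono _ _ kj).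
- rewrite all_rcons ek /= ltnSn /=; apply: sub_all lt_a => x /=; lia.
Qed.

End Diagonal.

Lemma finite_trace (Y : nat -> Prop) n :
  exists s, sorted ltn s /\ forall x, x \in s <-> Y x /\ x < n.
Proof.
exists (filter (fun x => `[< Y x >]) (iota 0 n)); split.
  by apply: sorted_filter; [exact: ltn_trans|exact: iota_ltn_sorted].
move=> x; rewrite mem_filter mem_iota /=; split=> [/andP[/asboolP]|[/asboolP -> ->]] //.
Qed.

(* The combinatorial forcing of Nash-Williams and Galvin-Prikry: [X] accepts [s]
   when every infinite subset of [X] put after [s] lands in [U]. *)
Theorem open_ramsey (X0 : nat -> Prop) (U : (nat -> Prop) -> Prop) : inf X0 ->
  (forall Y, inf Y -> subs Y X0 -> U Y ->
     exists n, forall Z, inf Z -> subs Z X0 -> agree n Y Z -> U Z) ->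
  exists X, [/\ inf X, subs X X0 &
    (forall Y, inf Y -> subs Y X -> U Y) \/ (forall Y, inf Y -> subs Y X -> ~ U Y)].
Proof.
move=> iX0 oU.
pose acc s X := forall Y, inf Y -> subs Y X -> U (join s Y).
have acc_sub s X Y : subs Y X -> acc s X -> acc s Y.
  by move=> sY a Z iZ sZ; apply: a => //; apply: subs_trans sZ sY.
pose rej s X := forall Y, inf Y -> subs Y X -> ~ acc s Y.
have rej_sub s X Y : subs Y X -> rej s X -> rej s Y.
  by move=> sY a Z iZ sZ; apply: a => //; apply: subs_trans sZ sY.
have [||X1 [iX1 sX1 dec]] := @diagonal X0 (fun s X => acc s X \/ rej s X) iX0.
- by move=> s X Y _ sY [/(acc_sub _ _ _ sY)|/(rej_sub _ _ _ sY)]; [left|right].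
- move=> s X iX _; have [[Y [iY sY a]]|h] := EM (exists Y, [/\ inf Y, subs Y X & acc s Y]).
    by exists Y; split=> //; left.
  by exists X; split=> //; right=> Y iY sY a; apply: h; exists Y.
pose inX1 s := sorted ltn s /\ forall x, x \in s -> X1 x.
have [a0|r0] := dec [::] isT (fun x => ltac:(by [])).
  exists X1; split=> //; left=> Y iY sY.
  by have := a0 Y iY; rewrite above_nil join_nil; apply.
(* Rejection is to pass from [s] to all its one-point extensions, hence by induction to every finite
   sequence in [X2]. *)
pose Psi s (X : nat -> Prop) := inX1 s -> rej s (above s X1) ->
  forall n, X n -> all (ltn^~ n) s -> rej (rcons s n) (above (rcons s n) X1).
have [||X2 [iX2 sX2 hX2]] := @diagonal X1 Psi iX1.
- by move=> s X Y iY sY h i r n /sY; apply: h.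
- move=> s X iX sX.
  have [[is1 rs]|h] := EM (inX1 s /\ rej s (above s X1)); last first.
    by exists X; split=> // is1 rs; case: h.
  have [Y [iY sY [aY|rY]]] := inf_split
      (fun n => all (ltn^~ n) s -> rej (rcons s n) (above (rcons s n) X1)) iX.
    by exists Y; split=> // _ _ n Yn; apply: aY.
  (* Otherwise [rcons s n] is accepted for every [n] in [Y], and then so is [s]: the least element
     of a set put after [s] serves as [n]. *)
  case: (rs Y iY).
    move=> n Yn; split; first by apply/sX/sY.
    by apply: contrapT => h; apply: (rY _ Yn) => h'; case: h.
  move=> W iW sW; have [m [Wm minW]] := inf_min iW.
  have Ym := sW _ Wm.
  have sm : all (ltn^~ m) s by apply: contrapT => h; apply: (rY _ Ym).
  have isr : inX1 (rcons s m).
    split; last by move=> x; rewrite mem_rcons inE => /orP[/eqP->|/(proj2 is1)//]; apply/sX/sY.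
    by apply/sorted_rconsP; case: is1.
  have [a|r] := dec _ (proj1 isr) (proj2 isr); last by case: (rY _ Ym) => _.
  have -> : join s W = join (rcons s m) (above [:: m] W).
    rewrite join_rcons; congr join; apply: setext => x; split=> [Wx|].
      have := minW _ Wx; rewrite leq_eqVlt => /orP[/eqP<-|lt].
        by left; rewrite inE.
      by right; split=> //=; rewrite lt.
    by case=> [|[]//]; rewrite inE => /eqP ->.
  apply: a; first exact: inf_above.
  move=> x [Wx]; rewrite /= andbT => mx; split; first by apply/sX/sY/sW.
  by rewrite all_rcons /= mx /=; apply: sub_all sm => y /=; lia.
have rejall s : sorted ltn s -> (forall x, x \in s -> X2 x) -> rej s (above s X1).
  elim/last_ind: s => [//|s m IH] so sX.
  have [ss lt_m] := proj1 (sorted_rconsP s m) so.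
  have sX' x : x \in s -> X2 x by move=> xs; apply: sX; rewrite mem_rcons inE xs orbT.
  apply: (hX2 s ss sX' _ (IH ss sX') m _ lt_m).
    by split=> // x /sX' /sX2.
  by split=> //; apply: sX; rewrite mem_rcons inE eqxx.
exists X2; split=> //; first exact: subs_trans sX2 sX1.
right=> Y iY sY UY.
have sY0 := subs_trans sY (subs_trans sX2 sX1).
(* By openness the part of [Y] below [n] already forces [U], so it is accepted, although every
   finite sequence is rejected. *)
have [n hn] := oU Y iY sY0 UY.
have [s [so sP]] := finite_trace Y n.
apply: (rejall s so _ (fun x => above s X1 x /\ n <= x)).
- by move=> x /sP [/sY].
- exact/inf_ge/inf_above.
- by move=> x [].
move=> Z iZ sZ; apply: hn; first exact: inf_join.
  by move=> x [/sP[/sY0]|/sZ [[/sX1]]].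
move=> x xn; split=> [Yx|[/sP[]|/sZ [_]]] //; last by lia.
by left; apply/sP.
Qed.

(** * Initial segments and barriers *)

(** For the empty sequence [init_seg] imposes a spurious condition through its default [last 0%N];
    this form is correct there too, and it splits [Y] by rewriting. *)
Definition init (s : seq nat) (Y : nat -> Prop) : Prop :=
  sorted ltn s /\ Y = join s (above s Y).

Lemma init_nil Y : init [::] Y.
Proof. by split=> //; rewrite join_nil above_nil. Qed.

Lemma init_mem s Y x : init s Y -> x \in s -> Y x.
Proof. by case=> _ -> ; left. Qed.

Lemma init_or s Y x : init s Y -> Y x -> x \in s \/ above s Y x.
Proof. by case=> _ {1}->. Qed.

Lemma above_join s W : (forall w, W w -> all (ltn^~ w) s) -> above s (join s W) = W.
Proof.
move=> h; apply: setext => x; split=> [[[xs /allP/(_ x xs) /=|//]]|Wx].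
  by rewrite ltnn.
by split; [right|exact: h].
Qed.

Lemma init_join s W : sorted ltn s -> (forall w, W w -> all (ltn^~ w) s) ->
  init s (join s W).
Proof. by move=> so h; split=> //; rewrite above_join. Qed.

Lemma init_above s X : sorted ltn s -> init s (join s (above s X)).
Proof. by move=> so; apply: init_join => // w []. Qed.

Lemma above_cat s u X : above (s ++ u) X = above u (above s X).
Proof.
apply: setext => x; rewrite /above all_cat; split; first by case=> ? /andP[].
by case=> -[? ->].
Qed.

Lemma init_cat s u Y : init (s ++ u) Y -> init s Y.
Proof.
move=> iY; have /sorted_catP[so _ lt] := proj1 iY.
split=> //; apply: setext => x; split=> [Yx|[xs|[]//]].
  case: (init_or iY Yx) => [|[_]]; last by rewrite all_cat => /andP[h _]; right.
  rewrite mem_cat => /orP[xs|xu]; first by left.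
  by right; split=> //; apply/allP => y ys; apply: lt.
by apply: init_mem iY _; rewrite mem_cat xs.
Qed.

Lemma init_tail s u Y : init (s ++ u) Y -> init u (above s Y).
Proof.
move=> iY; have /sorted_catP[so su lt] := proj1 iY.
split=> //; rewrite -above_cat; apply: setext => x; split.
  move=> [Yx ax]; case: (init_or iY Yx) => [|?]; last by right.
  by rewrite mem_cat => /orP[xs|?]; [move/allP/(_ x xs): ax; rewrite /= ltnn|left].
case=> [xu|[Yx]]; last by rewrite all_cat => /andP[].
split; first by apply: init_mem iY _; rewrite mem_cat xu orbT.
by apply/allP => y ys; apply: lt.
Qed.

Lemma init_head_min m s Y y : init (m :: s) Y -> Y y -> m <= y.
Proof.
move=> iY Yy; case: (init_or iY Yy) => [|[_ /= /andP[/ltnW]]] //.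
have /= := proj1 iY; rewrite (path_sortedE ltn_trans) inE => /andP[/allP h _].
by case/orP=> [/eqP->//|/h /ltnW].
Qed.

Lemma init_cmp s t Y : init s Y -> init t Y ->
  exists u, t = s ++ u \/ s = t ++ u.
Proof.
elim: s t Y => [|x s IH] t Y is1 it; first by exists t; left.
case: t it => [|y t] it; first by exists (x :: s); right.
have exy : x = y.
  apply/eqP; rewrite eqn_leq; apply/andP; split.
    by apply: init_head_min is1 _; apply: init_mem it _; rewrite inE eqxx.
  by apply: init_head_min it _; apply: init_mem is1 _; rewrite inE eqxx.
rewrite -exy in it *.
have [u [->|->]] := IH t _ (@init_tail [:: x] s Y is1) (@init_tail [:: x] t Y it).
  by exists u; left.
by exists u; right.
Qed.

Lemma sorted_le_last s x : sorted ltn s -> x \in s -> x <= last 0 s.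
Proof.
case/lastP: s => [//|s a] /sorted_rconsP[_ /allP h].
by rewrite last_rcons mem_rcons inE => /orP[/eqP->//|/h /ltnW].
Qed.

Lemma last_mem (s : seq nat) : s <> [::] -> last 0 s \in s.
Proof. by case/lastP: s => // s a _; rewrite last_rcons mem_rcons inE eqxx. Qed.

Lemma init_agree s Y Z : init s Y -> agree (last 0 s).+1 Y Z -> init s Z.
Proof.
move=> iY ag; have [so _] := iY; split=> //; apply: setext => x.
have le := @sorted_le_last s _ so.
split=> [Zx|[xs|[]//]]; last by apply/ag; [have := le x xs; lia|apply: init_mem iY _].
have [xl|xl] := ltnP x (last 0 s).+1.
  have Yx : Y x by apply/ag.
  by case: (init_or iY Yx) => [|[_ h]]; [left|right].
by right; split=> //; apply/allP => y /le /=; lia.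
Qed.

Lemma init_seg_init s Y : sorted ltn s -> s <> [::] -> init_seg s Y -> init s Y.
Proof.
move=> so s0 [h1 h2]; split=> //; apply: setext => x; split=> [Yx|[/h1//|[]//]].
have [xl|xl] := leqP x (last 0 s); first by left; apply: h2.
by right; split=> //; apply/allP => y /(sorted_le_last so) /=; lia.
Qed.

Lemma init_init_seg s Y : s <> [::] -> init s Y -> init_seg s Y.
Proof.
move=> s0 iY; split=> [x|x Yx xl]; first exact: init_mem.
case: (init_or iY Yx) => // -[_ /allP/(_ _ (last_mem s0)) /=]; lia.
Qed.

Lemma sorted_eq_mem (s t : seq nat) : sorted ltn s -> sorted ltn t -> s =i t -> s = t.
Proof. exact: irr_sorted_eq ltn_trans ltnn s t. Qed.

Lemma finite_sorted n : exists l : seq (seq nat),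
  forall s, sorted ltn s -> all (ltn^~ n) s -> s \in l.
Proof.
elim: n => [|n [l hl]]; first by exists [:: [::]] => -[].
exists (l ++ [seq rcons s n | s <- l]) => s so al; rewrite mem_cat.
case/lastP: s so al => [|s a] so; first by move=> _; rewrite hl.
have [so' /allP lt] := proj1 (sorted_rconsP s a) so.
rewrite all_rcons => /= /andP[an _].
have [ea|na] := eqVneq a n.
  apply/orP; right; apply/mapP; exists s; rewrite -?ea //.
  by apply: hl => //; rewrite -ea; apply/allP.
rewrite hl // all_rcons /=; apply/andP; split; first by lia.
by apply/allP => x /lt /=; lia.
Qed.

Lemma infinite_family (B : seq nat -> Prop) :
  (forall n, exists s, [/\ B s, s <> [::] & forall x, x \in s -> n <= x]) ->
  ~ exists l : seq (seq nat), forall s, B s -> s \in l.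
Proof.
move=> h [l hl]; pose M := \max_(s <- l) head 0 s.
have [[|a s] [Bs s0 ge]] := h M.+1; first by [].
have := ge a; rewrite inE eqxx => /(_ isT).
have : head 0 (a :: s) <= M by rewrite /M; apply: (leq_bigmax_seq (F := head 0) _ (hl _ Bs)).
rewrite /=; lia.
Qed.

Section Barrier.
Variables (C : seq nat -> Prop) (hC : barrier C).

Definition base (x : nat) : Prop := exists s, C s /\ x \in s.

Lemma barrier_sorted s : C s -> sorted ltn s.
Proof. by case: hC => h _ _ _; apply: h. Qed.

Lemma barrier_antichain s t : C s -> C t -> {subset s <= t} -> s = t.
Proof. by case: hC => _ _ h _; apply: h. Qed.

Lemma barrier_base_inf : inf base.
Proof.
move=> n; apply: contrapT => h; case: hC => so + _ _; apply.
have [l hl] := finite_sorted n; exists l => s Cs; apply: hl; first exact: so.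
apply/allP => x xs /=; rewrite ltnNge; apply/negP => nx.
by apply: h; exists x; split=> //; exists s.
Qed.

Lemma barrier_nonnil s : C s -> s <> [::].
Proof.
move=> Cs s0; case: hC => _ + _ _; apply; exists [:: [::]] => t Ct.
by rewrite s0 in Cs; rewrite -(barrier_antichain Cs Ct) ?inE.
Qed.

Lemma barrier_seg Y : inf Y -> subs Y base -> exists s, C s /\ init s Y.
Proof.
move=> iY sY; case: hC => so _ _ /(_ Y iY) [] // s [Cs s0 si].
by exists s; split=> //; apply: init_seg_init => //; apply: so.
Qed.

Lemma barrier_uniq s t Y : C s -> C t -> init s Y -> init t Y -> s = t.
Proof.
move=> Cs Ct is1 it; have [u [e|e]] := init_cmp is1 it.
  by apply: barrier_antichain => // x xs; rewrite e mem_cat xs.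
by apply/esym/barrier_antichain => // x xs; rewrite e mem_cat xs.
Qed.

Lemma segment_exists : exists c : (nat -> Prop) -> seq nat,
  forall Y, inf Y -> subs Y base -> C (c Y) /\ init (c Y) Y.
Proof.
have /choice[c hc] Y : exists s, inf Y -> subs Y base -> C s /\ init s Y.
  have [[iY sY]|h] := EM (inf Y /\ subs Y base).
    by have [s hs] := barrier_seg iY sY; exists s.
  by exists [::] => iY sY; case: h.
by exists c.
Qed.

(** Two initial segments of one set are comparable. Were [s] not a proper prefix of [m :: t], it
    would contain [t], hence equal it by the antichain property, while being longer. *)
Lemma barrier_step m Y s t : inf Y -> (forall y, Y y -> m < y) ->
  C s -> init s (join [:: m] Y) -> C t -> init t Y ->
  exists u, u <> [::] /\ m :: t = s ++ u.
Proof.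
move=> iY lt Cs is1 Ct it.
have im : init (m :: t) (join [:: m] Y).
  have [so eY] := it; rewrite {1}eY -join_cat; apply: init_join.
    rewrite /= (path_sortedE ltn_trans) so andbT.
    by apply/allP => x /(init_mem it) /lt.
  by move=> w [/lt lw aw] /=; rewrite lw.
have nomem : m \notin t by apply/negP => /(init_mem it) /lt; rewrite ltnn.
have [u [e|e]] := init_cmp is1 im.
  exists u; split=> // u0; rewrite u0 cats0 in e.
  have /(barrier_antichain Ct Cs) et : {subset t <= s}.
    by move=> x xt; rewrite -e inE xt orbT.
  by have := congr1 size e; rewrite -et /=; lia.
have /(barrier_antichain Ct Cs) et : {subset t <= s}.
  by move=> x xt; rewrite e /= inE mem_cat xt orbT.
by move: nomem; rewrite et e /= inE eqxx.
Qed.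

Lemma barrier_tri m Y s t : inf Y -> (forall y, Y y -> m < y) ->
  C s -> init s (join [:: m] Y) -> C t -> init t Y -> tri s t.
Proof.
move=> iY lt Cs is1 Ct it; have [u [u0 e]] := barrier_step iY lt Cs is1 Ct it.
exists (m :: t); split=> //; last by exists u.
rewrite /= (path_sortedE ltn_trans) (barrier_sorted Ct) andbT.
by apply/allP => x /(init_mem it) /lt.
Qed.

End Barrier.

(** * Well-orders *)

Section WellOrder.
Variables (A : Type) (lt : A -> A -> Prop) (hA : well_order lt).

Lemma wo_irr x : ~ lt x x. Proof. by case: hA. Qed.
Lemma wo_trans x y z : lt x y -> lt y z -> lt x z.
Proof. by case: hA => _ h _ _; apply: h. Qed.
Lemma wo_nlt x y : ~ lt x y -> x = y \/ lt y x.
Proof. by case: hA => _ _ /(_ x y) [|[]]; tauto. Qed.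

Lemma wo_le_lt x y z : ~ lt y x -> lt y z -> lt x z.
Proof. by move=> /wo_nlt [->//|h] /(wo_trans h). Qed.
Lemma wo_lt_le x y z : lt x y -> ~ lt z y -> lt x z.
Proof. by move=> xy /wo_nlt [->//|]; apply: wo_trans. Qed.
Lemma wo_asym x y : lt x y -> ~ lt y x.
Proof. by move=> xy /(wo_trans xy) /wo_irr. Qed.

Lemma wo_min (Q : A -> Prop) :
  (exists x, Q x) -> exists x, Q x /\ forall y, lt y x -> ~ Q y.
Proof.
case=> x; case: hA => _ _ _ wf; elim/(well_founded_ind wf): x => x IH Qx.
have [[y [yx Qy]]|h] := EM (exists y, lt y x /\ Q y); first exact: IH yx Qy.
by exists x; split=> // y yx Qy; apply: h; exists y.
Qed.

Definition increasing_on (I : A -> Prop) (f : A -> A) : Prop :=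
  forall x y, I x -> I y -> lt x y -> lt (f x) (f y).

(** Let [f x] be the least element of [J] above all earlier values. If this first gets stuck at [c]
    in [I], the values below [c] are cofinal in [J], and [s] in [J] is sent to the least [x] with
    [f x] at least [s]. *)
Lemma wo_compare (I J : A -> Prop) : inhabited A ->
  (forall x y, I x -> lt y x -> I y) ->
  (exists f, (forall x, I x -> J (f x)) /\ increasing_on I f) \/
  (exists f c, [/\ I c, forall x, J x -> lt (f x) c & increasing_on J f]).
Proof.
case=> a0 dI.
pose fit x (r : A -> A) s := J s /\ forall y, lt y x -> lt (r y) s.
pose least x r s := fit x r s /\ forall s', fit x r s' -> ~ lt s' s.
have /choice[nxt nxtP] : forall p : A * (A -> A), exists s,
    (exists s', fit p.1 p.2 s') -> least p.1 p.2 s.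
  move=> [x r] /=; have [h|h] := EM (exists s', fit x r s'); last by exists a0.
  have [s [h1 h2]] := wo_min h; exists s => _; split=> // s' hs' lts.
  exact: h2 lts hs'.
have wf : well_founded lt by case: hA.
have [f fP] : exists f : A -> A, forall x,
    (exists s, fit x f s) -> least x f (f x).
  pose F x (rec : forall y, lt y x -> A) :=
    nxt (x, fun y => if pselect (lt y x) is left h then rec y h else a0).
  exists (Fix wf (fun _ => A) F) => x.
  rewrite Fix_eq; last first.
    move=> y g h gh; congr (nxt (_, _)); apply: funext => z.
    by case: pselect => // p; rewrite gh.
  set f := Fix _ _ _; pose g y := if pselect (lt y x) is left _ then f y else a0.
  rewrite -/(F x (fun y _ => f y)) -[F _ _]/(nxt (x, g)).
  have fg y : lt y x -> g y = f y by rewrite /g => yx; case: pselect.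
  have fitE s : fit x f s <-> fit x g s.
    by split=> -[Js h]; split=> // y yx; [rewrite fg //|rewrite -fg //]; apply: h.
  move=> [s /fitE hs]; have [h1 h2] := nxtP (x, g) (ex_intro _ s hs).
  by split=> [|s' /fitE]; [apply/fitE|apply: h2].
have [all_fit|] := EM (forall x, I x -> exists s, fit x f s).
  left; exists f; split=> [x /all_fit /fP [[]]//|x y Ix Iy xy].
  by have [[_ h] _] := fP y (all_fit y Iy); apply: h.
move=> /existsNP [x1 /not_implyP [Ix1 nf1]]; right.
have [c [[Ic nfc] minc]] := @wo_min (fun x => I x /\ ~ exists s, fit x f s)
   (ex_intro _ x1 (conj Ix1 nf1)).
have fitc x : lt x c -> exists s, fit x f s.
  by move=> xc; apply: contrapT => h; apply: (minc x xc); split=> //; apply: dI xc.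
have /choice[g gP] s : exists x, J s ->
    [/\ lt x c, ~ lt (f x) s & forall y, lt y x -> lt (f y) s].
  have [Js|nJ] := EM (J s); last by exists a0.
  have [|x [[xc fx] minx]] := @wo_min (fun x => lt x c /\ ~ lt (f x) s).
    apply: contrapT => h; apply: nfc; exists s; split=> // y yc.
    by apply: contrapT => h'; apply: h; exists y.
  exists x => _; split=> // y yx; apply: contrapT => h.
  by apply: (minx y yx); split=> //; apply: wo_trans xc.
exists g, c; split=> // [x /gP []//|x y Jx Jy xy].
have [xc fx minx] := gP x Jx; have [yc fy miny] := gP y Jy.
(* If [g y] were at most [g x], then [f (g y)] would be below [y]: by minimality of [g x] if [g y]
   is smaller, and because [f (g x)] is at most [x] if they are equal. The choice of [g y] forbids
   this. *)
apply: contrapT => ngxy.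
have lfx : lt (f (g y)) y.
  have [e|gyx] := wo_nlt ngxy; last exact: wo_trans (minx _ gyx) xy.
  rewrite -e; have [_ least_fx] := fP _ (fitc _ xc).
  by apply: wo_le_lt xy; apply: least_fx; split.
exact: fy lfx.
Qed.

(* [I] plays the role of the largest power omega^b below the order type of [A]:
   it is the least initial segment of which finitely many copies, stacked on top
   of each other, receive an embedding of [A]. *)
Lemma indecomposable_segment : inhabited A ->
  exists (I : A -> Prop) (phi : nat * A -> nat * A),
  [/\ exists a, I a,
      forall p, I (phi p).2,
      forall p q, mul_omega_lt lt p q -> mul_omega_lt lt (phi p) (phi q) &
      forall b, I b -> exists f, (forall x, I x -> I (f x) /\ ~ lt (f x) b) /\
        increasing_on I f].
Proof.
move=> inhA.
pose covers (D : A -> Prop) := exists k (phi : A -> nat * A),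
  (forall x, (phi x).1 < k /\ D (phi x).2) /\
  forall x y, lt x y -> mul_omega_lt lt (phi x) (phi y).
have [I [covI dI minI]] : exists I, [/\ covers I, forall x y, I x -> lt y x -> I y &
    forall c, I c -> ~ covers (lt^~ c)].
  have [h|h] := EM (exists c, covers (lt^~ c)).
    have [c [hc minc]] := wo_min h; exists (lt^~ c); split=> //.
    by move=> x y xc yx; apply: wo_trans xc.
  exists (fun=> True); split=> //; last by move=> c _ hc; apply: h; exists c.
  exists 1, (fun x => (0, x)); split=> // x y xy; by right.
have [k [phi [phiI phi_lt]]] := covI.
have indec b : I b -> exists f, (forall x, I x -> I (f x) /\ ~ lt (f x) b) /\
    increasing_on I f.
  move=> Ib.
  have [[f [h1 h2]]|] := @wo_compare I (fun x => I x /\ ~ lt x b) inhA dI.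
    by exists f.
  case=> f [c [Ic fc fi]]; exfalso.
  have [d [Id bd cd]] : exists d, [/\ I d, ~ lt d b & ~ lt d c].
    have [bc|cb] := EM (lt b c).
      by exists c; split=> //; [apply: wo_asym|apply: wo_irr].
    by exists b; split=> //; apply: wo_irr.
  (* With [d] the larger of [b] and [c], each of the [k] copies of [I] splits into two pieces that
     fit below [d]: the part below [b], at an even index, and the part from [b] on, moved below [c]
     by [f], at the next odd index. *)
  apply: (minI d Id); exists (k.*2).
  exists (fun x => if pselect (lt (phi x).2 b) is left _ then (((phi x).1).*2, (phi x).2)
    else (((phi x).1).*2.+1, f (phi x).2)); split.
    move=> x; have [pk pI] := phiI x; case: pselect => h /=; split; try lia.
      exact: wo_lt_le h bd.
    by apply: wo_lt_le cd; apply: fc.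
  move=> x y xy; have [_ pI] := phiI x; have [_ qI] := phiI y.
  have := phi_lt x y xy; rewrite /mul_omega_lt.
  case: (phi x) pI => i x1 /= pI; case: (phi y) qI => j y1 /= qI.
  case=> [ij|[<- xy1]].
    by case: pselect => h; case: pselect => h' /=; left; lia.
  case: pselect => h; case: pselect => h' /=.
  - by right.
  - by left.
  - by case: h; apply: wo_trans h'.
  - by right; split=> //; apply: fi.
case: inhA => a0.
(* The copy of [A] numbered [m] occupies the [k] copies of [I] that start at number [m * k]. *)
exists I, (fun p => (p.1 * k + (phi p.2).1, (phi p.2).2)); split=> //.
- by exists (phi a0).2; case: (phiI a0).
- by move=> p; case: (phiI p.2).
move=> [m x] [n y]; rewrite /mul_omega_lt /=.
have [xk _] := phiI x; have [yk _] := phiI y.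
case=> [mn|[<- xy]]; first by left; nia.
by case: (phi_lt x y xy) => [h|[-> h]]; [left; lia|right].
Qed.

End WellOrder.

(** * The square of a barrier *)

Lemma inf_cons Y : inf Y -> exists m, [/\ Y m, Y = join [:: m] (above [:: m] Y),
  inf (above [:: m] Y) & forall y, above [:: m] Y y -> m < y].
Proof.
move=> iY; have [m [Ym minY]] := inf_min iY; exists m; split=> //.
- apply: setext => x; split=> [Yx|[|[]//]]; last by rewrite inE => /eqP ->.
  have := minY x Yx; rewrite leq_eqVlt => /orP[/eqP <-|mx]; first by left; rewrite inE.
  by right; split=> //=; rewrite mx.
- exact: inf_above.
- by move=> y [_ /= /andP[]].
Qed.

(** For a barrier [B] these are the unions of [s] and [t] in [B] with [tri s t]; the union is
    [m :: t] with [m] the head of [s]. *)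
Definition square (B : seq nat -> Prop) (r : seq nat) : Prop :=
  [/\ sorted ltn r, B (behead r) & exists s u, [/\ B s, u <> [::] & r = s ++ u]].

Lemma square_init B Y : barrier B -> inf Y -> subs Y (base B) ->
  exists r, [/\ square B r, r <> [::] & init r Y].
Proof.
move=> hB iY sY; have [m [Ym eY iY' lt]] := inf_cons iY.
have sY' : subs (above [:: m] Y) (base B) by move=> x [/sY].
have [s [Bs is1]] := barrier_seg hB iY sY.
have [t [Bt it]] := barrier_seg hB iY' sY'.
rewrite eY in is1.
have [u [u0 e]] := barrier_step hB iY' lt Bs is1 Bt it.
have imt : init (m :: t) Y.
  have [so et] := it; split.
    rewrite /= (path_sortedE ltn_trans) so andbT.
    by apply/allP => x /(init_mem it) /lt.
  by rewrite (@above_cat [:: m] t) (@join_cat [:: m] t) -et.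
exists (m :: t); split=> //; split=> //; first by case: imt.
by exists s, u.
Qed.

Lemma square_barrier B : barrier B -> barrier (square B).
Proof.
move=> hB; split.
- by move=> s [].
- apply: infinite_family => n.
  have iY := inf_ge n (barrier_base_inf hB).
  have [|r [r1 r2 r3]] := square_init hB iY; first by move=> x [].
  by exists r; split=> // x /(init_mem r3) [].
- move=> r r' [so Bt [s [u [Bs _ er]]]] [so' Bt' _] sub.
  have r0 : r <> [::].
    by move=> r0; move: er; rewrite r0; case: s Bs => // /(barrier_nonnil hB).
  case: r so Bt {er} sub r0 => [//|m t] /= so Bt sub _.
  case: r' so' Bt' sub => [|m' t'] /= so' Bt' sub; first by have := sub m (mem_head _ _).
  move: so so'; rewrite !(path_sortedE ltn_trans).
  move=> /andP[/allP lt _] /andP[/allP lt' _].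
  (* Since [m'] is at most [m], which is below all of [t], inclusion puts [t] inside [t'], so they
     are equal; then [m] can only be [m']. *)
  have m'm : m' <= m.
    by have := sub m (mem_head _ _); rewrite inE => /orP[/eqP ->//|/lt' /ltnW].
  have tt' : t = t'.
    apply: (barrier_antichain hB Bt Bt') => x xt.
    have := sub x; rewrite !inE xt orbT => /(_ isT) /orP[/eqP xm'|//].
    have /= := lt x xt; rewrite xm'; lia.
  rewrite -tt'; congr (_ :: _).
  have := sub m (mem_head _ _); rewrite inE -tt' => /orP[/eqP//|/lt].
  by rewrite /= ltnn.
- move=> X iX sX; have [|r [h1 h2 h3]] := square_init hB iX.
    move=> x /sX [r [[so Bt [s [u [Bs _ er]]]] xr]].
    case: r so Bt er xr => [//|m t] /= so Bt er; rewrite inE => /orP[/eqP->|]; last by exists t.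
    case: s Bs er => [/(barrier_nonnil hB)//|a s] Bs [ema _]; exists (a :: s).
    by rewrite ema mem_head.
  by exists r; split=> //; apply: init_init_seg.
Qed.

Lemma bqo_dom (A : Type) (ltA : A -> A -> Prop) (P : Type) (leP : P -> P -> Prop) :
  is_bqo (mul_omega_lt ltA) leP -> is_bqo ltA (@dom_le P leP).
Proof.
move=> bqo B hB [phi phiP] F; apply: contrapT => bad.
have badP s t : B s -> B t -> tri s t ->
    exists x, F s x /\ forall y, F t y -> ~ leP x y.
  move=> Bs Bt st; apply: contrapT => h; apply: bad; exists s, t; split=> // x Fx.
  by apply: contrapT => h'; apply: h; exists x; split=> // y Fy xy; apply: h'; exists y.
have sq r : square B r -> exists x s u, [/\ B s, u <> [::], r = s ++ u, F s x
    & forall y, F (behead r) y -> ~ leP x y].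
  case=> so Bt [s [u [Bs u0 er]]].
  have [|x [Fx hx]] := badP s (behead r) Bs Bt; last by exists x, s, u.
  by exists r; split=> //; exists u.
have [|r [sqr _ _]] := square_init hB (barrier_base_inf hB); first by [].
have [x0 _] := sq r sqr.
have /choice[g gP] r1 : exists x, square B r1 -> exists s u,
    [/\ B s, u <> [::], r1 = s ++ u, F s x & forall y, F (behead r1) y -> ~ leP x y].
  by have [/sq [x hx]|n] := EM (square B r1); [exists x|exists x0].
have [|r1 [r2 [sq1 sq2 t12 le12]]] := bqo _ (square_barrier hB) _ g.
  (* The head is the [omega] coordinate; the tail lies in [B] and supplies the [alpha]
     coordinate. *)
  exists (fun r1 => (head 0 r1, phi (behead r1))) => r1 r2 [_ B1 [s1 [u1 [Bs1 _ e1]]]].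
  case=> _ B2 [s2 [u2 [Bs2 _ e2]]].
  case: r1 B1 e1 => [|a r1] B1 e1 /=; first by case: s1 Bs1 e1 => // /(barrier_nonnil hB).
  case: r2 B2 e2 => [|b r2] B2 e2 //=.
  case/orP=> [ab|/andP[/eqP-> lx]]; first by left.
  by right; split=> //; apply: phiP.
have [s1 [u1 [Bs1 _ e1 _ no]]] := gP r1 sq1.
have [s2 [u2 [Bs2 _ e2 Fs2 _]]] := gP r2 sq2.
case: t12 => R [soR [v [v0 eR]] er2].
(* The tail of [r1] and [s2] are both initial segments of [r2] in [B], hence equal; so [g r2] lies
   in the very set that [g r1] was chosen to avoid. *)
apply: (no (g r2)) => //.
have -> // : behead r1 = s2.
case: sq1 => so1 B1 _; case: sq2 => so2 B2 _.
have r2E : r2 = behead r1 ++ v.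
  by rewrite er2 eR; case: (r1) e1 => // e1; case: (s1) Bs1 e1 => // /(barrier_nonnil hB).
have [Y ir] : exists Y, init r2 Y by exists (join r2 (above r2 xpredT)); apply: init_above.
apply: (@barrier_uniq B hB _ _ Y B1 Bs2).
  by rewrite r2E in ir; apply: init_cat ir.
by rewrite e2 in ir; apply: init_cat ir.
Qed.

(** * Restriction to countable sets, singletons and sequences *)

Lemma dom_cdom_bqo (A : Type) (ltA : A -> A -> Prop) (P : Type) (leP : P -> P -> Prop) :
  is_bqo ltA (@dom_le P leP) -> is_bqo ltA (@cdom_le P leP).
Proof. by move=> bqo B hB tB f; apply: (bqo B hB tB (fun s => proj1_sig (f s))). Qed.

(** On singletons [cdom_le] is [leP], and composing with [e] turns type at most omega into type at
    most alpha. *)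
Lemma cdom_omega_bqo (A : Type) (ltA : A -> A -> Prop) (P : Type) (leP : P -> P -> Prop) :
  (exists e : nat -> A, forall m n, (m < n)%N -> ltA (e m) (e n)) ->
  is_bqo ltA (@cdom_le P leP) -> is_bqo omega_lt leP.
Proof.
move=> [e eP] bqo B hB [phi phiP] f.
have cs p : countable_set (fun q : P => q = p) by exists (fun=> 0) => x y -> ->.
have [|s [t [Bs Bt st h]]] := bqo B hB _ (fun s => exist _ _ (cs (f s))).
  by exists (e \o phi) => s t Bs Bt /(phiP _ _ Bs Bt) /eP.
by exists s, t; split=> //; case: (h (f s) (erefl _)) => y [/= ->].
Qed.

Lemma cdom_sdom_bqo (A : Type) (ltA : A -> A -> Prop) (P : Type) (leP : P -> P -> Prop) :
  is_bqo ltA (@cdom_le P leP) -> is_bqo ltA (@sdom_le P leP).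
Proof.
move=> bqo B hB tB f.
have cs (x : nat -> P) : countable_set (range_of x).
  have /choice[g gP] p : exists i, range_of x p -> x i = p.
    by have [[i hi]|n] := EM (range_of x p); [exists i|exists 0].
  by exists g => p q /gP e1 /gP e2 eg; rewrite -e1 -e2 eg.
exact: (bqo B hB tB (fun s => exist _ _ (cs (proj1_sig (f s))))).
Qed.

(** * Homogeneous behaviour of the segments of a barrier *)

(** The singletons form a barrier of type omega, on which [tri] compares the elements. *)
Lemma omega_bqo_seq (P : Type) (leP : P -> P -> Prop) (p : nat -> P) :
  is_bqo omega_lt leP -> exists i j, i < j /\ leP (p i) (p j).
Proof.
move=> bqo; have hB : barrier (fun s => exists n, s = [:: n]).
  split.
  - by move=> s [n ->].
  - by apply: infinite_family => n; exists [:: n]; split=> //;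
      [exists n | move=> x; rewrite inE => /eqP ->].
  - move=> s t [m ->] [n ->] /(_ m); rewrite !inE eqxx => /(_ isT) /eqP -> //.
  - move=> X iX _; have [m [Xm minX]] := inf_min iX.
    exists [:: m]; split=> //; first by exists m.
    split=> x; first by rewrite inE => /eqP ->.
    by move=> /minX mx /= xm; rewrite inE eqn_leq mx xm.
have [|s [t [[m ->] [n ->] [r [so [u [u0 er]] et]] le]]] := bqo _ hB _ (fun s => p (head 0 s)).
  by exists (head 0) => s t [m ->] [n ->] /=; rewrite andbF orbF.
exists m, n; split=> //; move: so; rewrite er in et *; case: u u0 {er} et => // x u _ /= [<- _].
by case/andP.
Qed.

Lemma finite_max (Q : nat -> Prop) (le : nat -> nat -> Prop) N :
  (forall m n, Q m -> Q n -> m < N -> n < N -> le m n \/ le n m) ->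
  (forall l m n, le l m -> le m n -> le l n) ->
  (exists n, n < N /\ Q n) ->
  exists n, [/\ n < N, Q n & forall m, m < N -> Q m -> le m n].
Proof.
move=> tot tr; elim: N tot => [|N IH] tot [n [nN Qn]]; first by [].
have [ex|nex] := EM (exists n, n < N /\ Q n); last first.
  have eN m : m < N.+1 -> Q m -> m = N.
    rewrite ltnS leq_eqVlt => /orP[/eqP//|mN Qm]; case: nex; by exists m.
  exists n; split=> // m mN Qm.
  by have [] := tot m n Qm Qn mN nN; rewrite (eN m mN Qm) (eN n nN Qn).
have [|a [aN Qa amax]] := IH _ ex.
  by move=> m m' Qm Qm' ml ml'; apply: tot => //; apply: ltnW.
have [QN|nQN] := EM (Q N); last first.
  exists a; split=> //; first exact: ltnW.
  by move=> m; rewrite ltnS leq_eqVlt => /orP[/eqP -> /nQN|/amax].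
have [aleN|Nlea] := tot a N Qa QN (ltnW aN) (ltnSn N).
  exists N; split=> // m; rewrite ltnS leq_eqVlt => /orP[/eqP -> _|mN Qm].
    by case: (tot N N QN QN (ltnSn N) (ltnSn N)).
  exact: tr (amax m mN Qm) aleN.
exists a; split=> //; first exact: ltnW.
by move=> m; rewrite ltnS leq_eqVlt => /orP[/eqP -> |/amax].
Qed.

Lemma agree_join n s Y Z : agree n Y Z -> agree n (join s Y) (join s Z).
Proof.
by move=> ag x /ag h; split=> [] [xs|/h hx]; by [left|right].
Qed.

Lemma agree_le m n Y Z : m <= n -> agree n Y Z -> agree m Y Z.
Proof. by move=> mn ag x xm; apply: ag; apply: leq_trans mn. Qed.

Section Segments.
Variables (C : seq nat -> Prop) (hC : barrier C) (c : (nat -> Prop) -> seq nat).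
Hypothesis cP : forall Y, inf Y -> subs Y (base C) -> C (c Y) /\ init (c Y) Y.
Implicit Types (s t : seq nat) (X Y Z : nat -> Prop).

Definition in_base s : Prop := forall x, x \in s -> base C x.

Lemma join_base s X : in_base s -> subs X (base C) -> subs (join s X) (base C).
Proof. by move=> sb sX x [/sb|/sX]. Qed.

Lemma segment_eq s Y : inf Y -> subs Y (base C) -> C s -> init s Y -> c Y = s.
Proof. by move=> iY sY Cs is1; have [h1 h2] := cP iY sY; apply: (barrier_uniq hC) h2 is1. Qed.

Lemma segment_agree Y Z : inf Y -> inf Z -> subs Y (base C) -> subs Z (base C) ->
  agree (last 0 (c Y)).+1 Y Z -> c Z = c Y.
Proof.
move=> iY iZ sY sZ ag; have [CY inY] := cP iY sY.
by apply: segment_eq => //; apply: init_agree ag.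
Qed.

(** A segment depends on a finite part of the set, so conditions on segments are open and
    [open_ramsey] applies to them. *)
Lemma segment_open s Y : in_base s -> inf Y -> subs Y (base C) ->
  exists n, forall Z, inf Z -> subs Z (base C) -> agree n Y Z ->
    c (join s Z) = c (join s Y).
Proof.
move=> sb iY sY; exists (last 0 (c (join s Y))).+1 => Z iZ sZ ag.
by apply: segment_agree; [exact: inf_join|exact: inf_join|exact: join_base
  |exact: join_base|exact: agree_join].
Qed.

Lemma segment_cons n Y : base C n -> inf Y -> subs Y (base C) -> (forall y, Y y -> n < y) ->
  exists t, c (join [:: n] Y) = n :: t /\ init t Y.
Proof.
move=> bn iY sY lt.
have [|Cs is1] := cP (inf_join [:: n] iY); first by apply: join_base sY => x; rewrite inE => /eqP ->.
have is2 : init [:: n] (join [:: n] Y).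
  by apply: init_join => // w /lt /= ->.
case: (c _) Cs is1 => [/(barrier_nonnil hC)//|a t] Cs is1.
have [u [[ea _]|]] := init_cmp is2 is1.
  exists t; rewrite ea in is1 *; split=> //.
  rewrite -(@above_join [:: n] Y); last by move=> w /lt /= ->.
  exact: (@init_tail [:: n] t).
case=> ea e; exists t; rewrite -ea; split=> //.
by case: (t) e => // _; apply: init_nil.
Qed.

Section Colorings.
Variables (P : Type) (f : seq nat -> P).

Definition far s Y Z : Prop := forall z, Z z -> last 0 (c (join s Y)) < z.

(* A relation between consecutive segments is a colouring of [Y], and by
   splicing it controls all pairs of segments lying far apart. *)
Lemma pair_ramsey (Rel : P -> P -> Prop) s X : in_base s -> inf X -> subs X (base C) ->
  exists X', [/\ inf X', subs X' X &
    (forall Y Z, inf Y -> inf Z -> subs Y X' -> subs Z X' -> far s Y Z ->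
       Rel (f (c (join s Y))) (f (c (join s Z)))) \/
    (forall Y Z, inf Y -> inf Z -> subs Y X' -> subs Z X' -> far s Y Z ->
       ~ Rel (f (c (join s Y))) (f (c (join s Z))))].
Proof.
move=> sb iX sX.
pose tl Y := fun x => Y x /\ last 0 (c (join s Y)) < x.
have tl_inf Y : inf Y -> inf (tl Y) by apply: inf_ge.
have tl_sub Y : subs (tl Y) Y by move=> x [].
pose U Y := Rel (f (c (join s Y))) (f (c (join s (tl Y)))).
have [|X' [iX' sX' hX']] := @open_ramsey X U iX.
  move=> Y iY /subs_trans/(_ sX) sY.
  have [n1 h1] := segment_open sb iY sY.
  have [n2 h2] := segment_open sb (tl_inf Y iY) (subs_trans (@tl_sub Y) sY).
  rewrite /U => UY; exists (maxn n1 n2) => Z iZ /subs_trans/(_ sX) sZ ag.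
  have e1 := h1 Z iZ sZ (agree_le (leq_maxl _ _) ag).
  rewrite e1 (h2 (tl Z)) //; [exact: tl_inf|exact: subs_trans sZ|].
  by move=> x /(agree_le (leq_maxr n1 n2) ag) h; rewrite /tl e1 h.
exists X'; split=> //.
have mix Y Z : inf Y -> inf Z -> subs Y X' -> subs Z X' -> far s Y Z ->
    exists W, [/\ inf W, subs W X', c (join s W) = c (join s Y) & tl W = Z].
  move=> iY iZ sY sZ fYZ.
  pose W x := (Y x /\ x <= last 0 (c (join s Y))) \/ Z x.
  have iW : inf W by apply: inf_sub iZ _ => x; right.
  have sW : subs W X' by move=> x [[/sY]|/sZ].
  have toB V : subs V X' -> subs (join s V) (base C).
    by move=> sV; apply: join_base => // x /sV /sX' /sX.
  have eW : c (join s W) = c (join s Y).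
    apply: segment_agree; [exact: inf_join|exact: inf_join|exact: toB|exact: toB|].
    apply: agree_join => x xl; split=> [Yx|[[]//|/fYZ]]; [by left|by lia].
  exists W; split=> //; apply: setext => x; rewrite /tl eW.
  split=> [[[[_ h1]|//] h2]|Zx]; first by lia.
  by split; [right|exact: fYZ].
by case: hX' => h; [left|right] => Y Z iY iZ sY sZ fYZ;
  have [W [iW sW e1 e2]] := mix Y Z iY iZ sY sZ fYZ; have := h W iW sW; rewrite /U e1 e2.
Qed.

Variable leP : P -> P -> Prop.

(** The guard [in_base s] makes the property dense at every finite sequence, as [diagonal] demands;
    outside the base nothing is known of [c]. *)
Definition monotone_at s X : Prop := in_base s ->
  (forall Y Z, inf Y -> inf Z -> subs Y X -> subs Z X -> far s Y Z ->
     leP (f (c (join s Y))) (f (c (join s Z)))) /\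
  ((forall Y Z, inf Y -> inf Z -> subs Y X -> subs Z X -> far s Y Z ->
     f (c (join s Y)) = f (c (join s Z))) \/
   (forall Y Z, inf Y -> inf Z -> subs Y X -> subs Z X -> far s Y Z ->
     f (c (join s Y)) <> f (c (join s Z)))).

Lemma monotone_at_hereditary : hereditary monotone_at.
Proof.
move=> s X Y iY sY h sb; have [h1 h2] := h sb.
split=> [Z W iZ iW sZ sW|]; first by apply: h1 => //; apply: subs_trans sY.
by case: h2 => h2; [left|right] => Z W iZ iW sZ sW; apply: h2 => //; apply: subs_trans sY.
Qed.

Lemma monotone_at_dense : is_bqo omega_lt leP -> dense (base C) monotone_at.
Proof.
move=> bqo s X iX sX; have [sb|nb] := EM (in_base s); last by exists X; split=> // /nb.
have [X1 [iX1 sX1 hX1]] := pair_ramsey leP sb iX sX.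
have [X2 [iX2 sX2 hX2]] := pair_ramsey eq sb iX1 (subs_trans sX1 sX).
exists X2; split=> //; first exact: subs_trans sX2 sX1.
move=> _; split=> //; case: hX1 => [h Y Z iY iZ sY sZ|h].
  by apply: h => //; apply: subs_trans sX2.
(* If [leP] failed between all segments far apart, the successive remainders [Y k] would give a bad
   sequence in [P]. *)
pose tl Y := fun x => Y x /\ last 0 (c (join s Y)) < x.
pose Y k := iter k tl X1.
have iY k : inf (Y k) by elim: k => //= k; apply: inf_ge.
have mono i j : subs (Y (i + j)) (Y i).
  by elim: j => [|j IH]; rewrite ?addn0 // addnS => x [/IH].
have [i [j [ij le]]] := omega_bqo_seq (fun k => f (c (join s (Y k)))) bqo.
exfalso; apply: (h (Y i) (Y j)) le => //; [exact: (mono 0)|exact: (mono 0)|].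
by move=> z; rewrite -(subnKC ij) => /mono [].
Qed.

End Colorings.

(** Only one-term [s] are constrained; the general [s] is the format that [diagonal] takes. The same
    holds for triples in [comparable_at]. *)
Definition same_block (h : seq nat -> nat) s X : Prop := forall n, s = [:: n] -> base C n ->
  exists k, forall Y, inf Y -> subs Y X -> h (c (join [:: n] Y)) = k.

Lemma same_block_hereditary h : hereditary (same_block h).
Proof.
move=> s X Y iY sY hs n en bn; have [k hk] := hs n en bn.
by exists k => Z iZ sZ; apply: hk => //; apply: subs_trans sY.
Qed.

Lemma bounded_ramsey (h : seq nat -> nat) s K X : in_base s -> inf X -> subs X (base C) ->
  (forall Y, inf Y -> subs Y X -> h (c (join s Y)) < K) ->
  exists X' k, [/\ inf X', subs X' X & forall Y, inf Y -> subs Y X' -> h (c (join s Y)) = k].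
Proof.
move=> sb; elim: K X => [|K IH] X iX sX bd; first by have := bd X iX (@subs_refl X).
have [|X' [iX' sX' hX']] := @open_ramsey X (fun Y => h (c (join s Y)) < K) iX.
  move=> Y iY /subs_trans/(_ sX) sY hY; have [n hn] := segment_open sb iY sY.
  by exists n => Z iZ /subs_trans/(_ sX) sZ /(hn Z iZ sZ) ->.
case: hX' => h'.
  have [X2 [k [h1 h2 h3]]] := IH X' iX' (subs_trans sX' sX) h'.
  by exists X2, k; split=> //; apply: subs_trans sX'.
exists X', K; split=> // Y iY sY; apply/eqP; rewrite eqn_leq.
rewrite -ltnS bd //=; last exact: subs_trans sX'.
by rewrite leqNgt; apply/negP/h'.
Qed.

(** A segment starting with [n] lexicographically precedes the segment of [X] beyond [n], so only
    finitely many blocks occur and [bounded_ramsey] selects one. *)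
Lemma same_block_dense (h : seq nat -> nat) :
  (forall s t, C s -> C t -> lexlt s t -> h s <= h t) -> dense (base C) (same_block h).
Proof.
move=> hmono s X iX sX.
have [[n [en bn]]|nn] := EM (exists n, s = [:: n] /\ base C n); last first.
  by exists X; split=> // n en bn; case: nn; exists n.
have sb : in_base [:: n] by move=> x; rewrite inE => /eqP ->.
have iX' := inf_above [:: n] iX.
have sX' : subs (above [:: n] X) (base C) by move=> x [/sX].
have [CX inX] := cP iX' sX'.
have [Y iY sY|X2 [k [h1 h2 h3]]] := @bounded_ramsey h [:: n] (h (c (above [:: n] X))).+1 _ sb iX' sX'.
- rewrite ltnS; apply: hmono => //.
    by apply: (proj1 (cP _ _)); [exact: inf_join|apply: join_base => //; apply: subs_trans sX'].
  have [|t [-> _]] := segment_cons bn iY (subs_trans sY sX').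
    by move=> y /sY [_ /= /andP[]].
  case: (c _) CX inX => [/(barrier_nonnil hC)//|a u] _ /init_mem -/(_ a (mem_head _ _)).
  by case=> _ /= /andP[->].
- exists X2; split=> //; first exact: subs_trans h2 (@above_sub [:: n] X).
  move=> n' en' _; rewrite en in en'; case: en' => <-.
  by exists k.
Qed.

Definition comparable_at s X : Prop := forall n n' m, s = [:: n; n'; m] -> in_base s ->
  (forall Y, inf Y -> subs Y X -> size (c (join [:: n; m] Y)) <= size (c (join [:: n'; m] Y))) \/
  (forall Y, inf Y -> subs Y X -> size (c (join [:: n'; m] Y)) <= size (c (join [:: n; m] Y))).

Lemma comparable_at_hereditary : hereditary comparable_at.
Proof.
move=> s X Y iY sY hs n n' m e sb.
by case: (hs n n' m e sb) => h; [left|right] => Z iZ sZ; apply: h => //; apply: subs_trans sY.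
Qed.

Lemma comparable_at_dense : dense (base C) comparable_at.
Proof.
move=> s X iX sX.
have [[n [n' [m [e sb]]]]|nn] := EM (exists n n' m, s = [:: n; n'; m] /\ in_base s); last first.
  by exists X; split=> // n n' m e sb; case: nn; exists n, n', m.
have sb1 : in_base [:: n; m].
  by move=> x; rewrite !inE => h; apply: sb; rewrite e !inE; case/orP: h => ->; rewrite ?orbT.
have sb2 : in_base [:: n'; m].
  by move=> x; rewrite !inE => h; apply: sb; rewrite e !inE; case/orP: h => ->; rewrite ?orbT.
have [|X' [iX' sX' hX']] := @open_ramsey X
    (fun Y => size (c (join [:: n; m] Y)) <= size (c (join [:: n'; m] Y))) iX.
  move=> Y iY /subs_trans/(_ sX) sY hY.
  have [k1 h1] := segment_open sb1 iY sY; have [k2 h2] := segment_open sb2 iY sY.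
  exists (maxn k1 k2) => Z iZ /subs_trans/(_ sX) sZ ag.
  by rewrite h1 ?h2 //; [apply: agree_le ag; apply: leq_maxr|apply: agree_le ag; apply: leq_maxl].
exists X'; split=> // a a' b e' _; rewrite e in e'; case: e' => <- <- <-.
case: hX' => h; [left|right] => // Y iY sY.
by have /negP := h Y iY sY; rewrite -ltnNge => /ltnW.
Qed.

End Segments.

(** * From a bad map on a barrier to a bad map into the strictly increasing sequences *)

Lemma lexlt_irr s : lexlt s s = false.
Proof. by elim: s => //= x s ->; rewrite ltnn eqxx. Qed.

Lemma lexlt_cat s t u v : lexlt s t -> (forall w, t <> s ++ w) ->
  lexlt (s ++ u) (t ++ v).
Proof.
elim: s t => [|x s IH] [|y t] //=; first by move=> _ /(_ (y :: t)).
case/orP=> [->//|/andP[/eqP -> lx]] h; rewrite eqxx IH ?orbT // => w e.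
by apply: (h w); rewrite e.
Qed.

Section Descent.
Variables (C : seq nat -> Prop) (hC : barrier C) (c : (nat -> Prop) -> seq nat).
Hypothesis cP : forall Y, inf Y -> subs Y (base C) -> C (c Y) /\ init (c Y) Y.
Variables (P : Type) (leP : P -> P -> Prop) (f : seq nat -> P).
Hypothesis leP_trans : forall x y z, leP x y -> leP y z -> leP x z.
Hypothesis bad : forall s t, C s -> C t -> tri s t -> ~ leP (f s) (f t).
Variable X1 : nat -> Prop.
Hypotheses (iX1 : inf X1) (sX1 : subs X1 (base C)).
Implicit Types (s t u : seq nat) (X Y Z : nat -> Prop).

Definition within X s : Prop := forall x, x \in s -> X x.

Hypothesis mono : forall s, sorted ltn s -> within X1 s ->
  monotone_at C c f leP s (above s X1).

Definition const s : Prop := forall Y Z, inf Y -> inf Z ->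
  subs Y (above s X1) -> subs Z (above s X1) -> f (c (join s Y)) = f (c (join s Z)).

Lemma join_within s X Y : within X s -> subs Y X -> subs (join s Y) X.
Proof. by move=> ws sY x [/ws|/sY]. Qed.

Lemma within_base s : within X1 s -> in_base C s.
Proof. by move=> ws x /ws /sX1. Qed.

Lemma const_or_far s : sorted ltn s -> within X1 s -> const s \/
  forall Y Z, inf Y -> inf Z -> subs Y (above s X1) -> subs Z (above s X1) ->
    far c s Y Z -> f (c (join s Y)) <> f (c (join s Z)).
Proof.
move=> so ws; have [_ [h|h]] := mono so ws (within_base ws); [left|by right].
move=> Y Z iY iZ sY sZ.
(* Two values are compared through a third one, from a set lying beyond both segments. *)
pose N := maxn (last 0 (c (join s Y))) (last 0 (c (join s Z))).
have iW := inf_ge N.+1 (inf_above s iX1).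
have sW : subs (fun x => above s X1 x /\ N.+1 <= x) (above s X1) by move=> x [].
rewrite (h Y _ iY iW sY sW); last by move=> z [_]; rewrite /N; lia.
by rewrite (h Z _ iZ iW sZ sW) // => z [_]; rewrite /N; lia.
Qed.

Lemma subs_join_above p u Y : sorted ltn (p ++ u) -> within X1 u ->
  subs Y (above (p ++ u) X1) -> subs (join u Y) (above p X1).
Proof.
move=> /sorted_catP[_ _ lt] wu sY x [xu|/sY]; last by rewrite above_cat => /above_sub; rewrite /above.
  by split; [exact: wu|apply/allP => y yp; apply: lt].
Qed.

Lemma const_cat p u : const p -> sorted ltn (p ++ u) -> within X1 u -> const (p ++ u).
Proof.
move=> cp so wu Y Z iY iZ sY sZ; rewrite !join_cat.
by apply: cp; [exact: inf_join|exact: inf_join|exact: subs_join_above sY|exact: subs_join_above sZ].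
Qed.

Lemma segment_join q Y : C q -> within X1 q -> inf Y -> subs Y (above q X1) -> c (join q Y) = q.
Proof.
move=> Cq wq iY sY; apply: (segment_eq hC cP) => //; first exact: inf_join.
  by move=> x [/wq/sX1|/sY [/sX1]].
by apply: init_join; [exact: (barrier_sorted hC)|move=> w /sY []].
Qed.

Lemma const_segment q : C q -> within X1 q -> const q.
Proof. by move=> Cq wq Y Z iY iZ sY sZ; rewrite !segment_join. Qed.

(* If the value of [f] did not depend on what follows [m], a late segment [v]
   would satisfy f(m v ..) <= f(v) by monotonicity at the empty sequence. *)
Lemma const_singleton m : X1 m -> ~ const [:: m].
Proof.
move=> Xm cm.
have so : sorted ltn [::] by [].
have [mono0 _] := mono so (fun x => ltac:(by [])) (fun x => ltac:(by [])).
have wm : within X1 [:: m] by move=> x; rewrite inE => /eqP ->.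
pose Y := above [:: m] X1.
have iY : inf Y by apply: inf_above.
pose W x := Y x /\ (last 0 (c (join [:: m] Y))).+1 <= x.
have iW : inf W by apply: inf_ge.
have sWY : subs W Y by move=> x [].
have sWX : subs W X1 by move=> x /sWY [].
have sW : subs W (base C) by move=> x /sWX /sX1.
have [CW inW] := cP iW sW.
have sjW : subs (join [:: m] W) X1 by apply: join_within.
have [CmW inmW] := cP (inf_join [:: m] iW) (subs_trans sjW sX1).
apply: (bad CmW CW).
  by apply: (barrier_tri hC iW _ CmW inmW CW inW) => y /sWY [_ /= /andP[]].
rewrite (cm W Y) //.
have := mono0 (join [:: m] Y) W (inf_join _ iY) iW.
rewrite above_nil !join_nil; apply=> //.
  by apply: join_within => // x [].
by move=> z [_]; rewrite join_nil.
Qed.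

Lemma const_nil : ~ const [::].
Proof.
move=> c0; have [m [Xm _]] := inf_min iX1; apply: (const_singleton Xm).
by apply: (const_cat c0 (u := [:: m])) => // x; rewrite inE => /eqP ->.
Qed.

Definition uniform_at s X : Prop :=
  (forall m, X m -> const (rcons s m)) \/ (forall m, X m -> ~ const (rcons s m)).

Lemma uniform_exists : exists X, [/\ inf X, subs X X1 &
  forall s, sorted ltn s -> within X s -> uniform_at s (above s X)].
Proof.
apply: (diagonal iX1).
- by move=> s X Y _ sY [h|h]; [left|right] => m /sY; apply: h.
- move=> s X iX _; have [Y [iY sY h]] := inf_split (fun m => const (rcons s m)) iX.
  by exists Y.
Qed.

Variable X2 : nat -> Prop.
Hypotheses (iX2 : inf X2) (sX2 : subs X2 X1).
Hypothesis unif : forall s, sorted ltn s -> within X2 s -> uniform_at s (above s X2).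
Variable nu : nat -> nat.
Hypothesis nuP : forall m, X2 m -> [/\ X1 (nu m), nu m < m &
  forall n, X1 n -> n < m -> forall Y, inf Y -> subs Y (above [:: m] X1) ->
    size (c (join [:: n; m] Y)) <= size (c (join [:: nu m; m] Y))].

(** * The front on which the new bad map lives *)

Definition is_tail s : Prop := s <> [::] /\ C (nu (head 0 s) :: s).
(** The last moment at which the value still varies: variation yields a strictly increasing
    sequence, while constancy one element later yields badness. *)
Definition pre_const s : Prop :=
  ~ const s /\ forall m, above s X2 m -> const (rcons s m).
Definition stops s : Prop := is_tail s \/ pre_const s.
Definition front s : Prop := [/\ sorted ltn s, within X2 s, s <> [::], stops s &
  forall p u, s = p ++ u -> p <> [::] -> u <> [::] -> ~ stops p].

Lemma front_prefix s t u : front s -> front t -> t = s ++ u -> u = [::].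
Proof.
move=> [_ _ s0 ss _] [_ _ _ _ h] e; apply: contrapT => u0.
exact: (h s u).
Qed.

Lemma front_uniq s t Y : front s -> front t -> init s Y -> init t Y -> s = t.
Proof.
move=> Fs Ft is1 it; have [u [e|e]] := init_cmp is1 it.
  by rewrite e (front_prefix Fs Ft e) cats0.
by rewrite e (front_prefix Ft Fs e) cats0.
Qed.

Lemma tail_exists Y : inf Y -> subs Y X2 -> exists t, is_tail t /\ init t Y.
Proof.
move=> iY sY; have [m [Ym eY iY' lt]] := inf_cons iY.
have [Xn nm _] := nuP (sY m Ym).
have ltn' y : Y y -> nu m < y.
  by rewrite eY => -[|/lt]; [rewrite inE => /eqP->|lia].
have sYX x : Y x -> X1 x by move=> /sY /sX2.
have sYb : subs Y (base C) by move=> x /sYX /sX1.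
have [t [et it]] := segment_cons hC cP (sX1 Xn) iY sYb ltn'.
have [|Ct _] := cP (inf_join [:: nu m] iY).
  by apply: join_base => // x; rewrite inE => /eqP ->; apply: sX1.
rewrite et in Ct.
have t0 : t <> [::].
  move=> t0; rewrite t0 in Ct; apply: (const_singleton Xn); apply: const_segment => //.
  by move=> x; rewrite inE => /eqP ->.
exists t; split=> //; split=> //; suff -> : head 0 t = m by [].
case: t it t0 {et Ct} => [//|a t] it _ /=; apply/eqP; rewrite eqn_leq.
rewrite (init_head_min it Ym) /=.
have : Y a by apply: init_mem it (mem_head _ _).
by rewrite eY => -[|/lt/ltnW//]; rewrite inE => /eqP ->.
Qed.

(** Take the shortest nonempty prefix of the tail that stops. The remainder [u] is recorded because
    the order type is bounded by means of the full tail. *)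
Lemma front_exists Y : inf Y -> subs Y X2 -> exists s u,
  [/\ front s, init s Y, is_tail (s ++ u) & init (s ++ u) Y].
Proof.
move=> iY sY; have [t [tt it]] := tail_exists iY sY.
have [|k [[k0 sk] kmin]] := @nat_min (fun k => 0 < k /\ stops (take k t)).
  exists (size t); rewrite take_size; split; last by left.
  by case: tt; case: (t).
have it' : init (take k t ++ drop k t) Y by rewrite cat_take_drop.
exists (take k t), (drop k t); rewrite cat_take_drop; split=> //.
  have is1 := init_cat it'; split=> //; first by case: is1.
  - by move=> x /(init_mem is1) /sY.
  - by case: (t) (proj1 tt) (k) k0 => // a l _ [].
  move=> p u e p0 u0 sp; apply: (kmin (size p)).
    have := congr1 size e; rewrite size_cat; have : size u > 0 by case: (u) u0.
    have : size (take k t) <= k by rewrite size_take; case: ltnP.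
    lia.
  split; first by case: (p) p0.
  have <- // : p = take (size p) t.
  by rewrite -(cat_take_drop k t) e -catA take_size_cat.
exact: init_cat it'.
Qed.

(** The prefix just before the shortest constant one is nonempty by [const_singleton] and, by
    uniformity, already [pre_const]; so [s] would not be minimal. *)
Lemma front_nonconst s : front s -> ~ const s.
Proof.
move=> [so ws s0 _ mins] cs.
have [|k [ck kmin]] := @nat_min (fun k => const (take k s)).
  by exists (size s); rewrite take_size.
case: k ck kmin => [|k] ck kmin; first by apply: const_nil; rewrite take0 in ck.
have ks : k < size s.
  rewrite ltnNge; apply/negP => sk; apply: (kmin (size s)); first by lia.
  by rewrite take_size.
have es : s = take k s ++ nth 0 s k :: drop k.+1 s by rewrite -drop_nth ?cat_take_drop.
have Xz : X2 (nth 0 s k) by apply: ws; apply: mem_nth.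
have ek : take k.+1 s = rcons (take k s) (nth 0 s k) by apply: take_nth.
have p0 : take k s <> [::].
  move=> p0; apply: (const_singleton (sX2 Xz)).
  by rewrite ek p0 in ck.
have nc : ~ const (take k s) by apply: kmin.
apply: (mins (take k s) (nth 0 s k :: drop k.+1 s)) => //; right; split=> //.
have := so; rewrite {1}es => /sorted_catP[sop _ lt].
have wp : within X2 (take k s) by move=> x /mem_take /ws.
case: (unif sop wp) => [//|h]; exfalso; apply: (h (nth 0 s k)); last by rewrite -ek.
by split=> //; apply/allP => y /lt; apply; rewrite mem_head.
Qed.

(** Colour an infinite set by its unique initial segment in the front; this colouring is open. *)
Lemma front_ramsey (V : seq nat -> Prop) X : inf X -> subs X X2 ->
  exists X', [/\ inf X', subs X' X &
    (forall s, front s -> within X' s -> V s) \/ (forall s, front s -> within X' s -> ~ V s)].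
Proof.
move=> iX sX.
have /choice[d dP] Y : exists s, inf Y -> subs Y X2 -> front s /\ init s Y.
  have [[iY sY]|n] := EM (inf Y /\ subs Y X2).
    by have [s [u [h1 h2 _ _]]] := front_exists iY sY; exists s.
  by exists [::] => iY sY; case: n.
have [|X' [iX' sX' hX']] := @open_ramsey X (fun Y => V (d Y)) iX.
  move=> Y iY /subs_trans/(_ sX) sY VY; have [FY inY] := dP Y iY sY.
  exists (last 0 (d Y)).+1 => Z iZ /subs_trans/(_ sX) sZ ag; have [FZ inZ] := dP Z iZ sZ.
  by rewrite (front_uniq FZ FY inZ (init_agree inY ag)).
have V_iff s : front s -> within X' s -> exists Y, [/\ inf Y, subs Y X' & d Y = s].
  move=> Fs ws; exists (join s (above s X')).
  have iY := inf_join s (inf_above s iX').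
  have sY : subs (join s (above s X')) X' by apply: join_within => // x [].
  split=> //; have [FY inY] := dP _ iY (subs_trans sY (subs_trans sX' sX)).
  by apply: (front_uniq FY Fs inY); apply: init_above; case: Fs.
exists X'; split=> //; case: hX' => h; [left|right] => s Fs ws;
  by have [Y [iY sY <-]] := V_iff s Fs ws; apply: h.
Qed.

(** No front member is a proper prefix of another, but proper inclusions may occur. Members are
    coloured by whether they properly contain another one; if all did, sizes would descend
    forever. *)
Lemma restricted_front : exists X, [/\ inf X, subs X X2,
  barrier (fun s => front s /\ within X s) &
  (forall s, front s -> within X s -> is_tail s) \/
  (forall s, front s -> within X s -> pre_const s)].
Proof.
have [X3 [iX3 sX3 h3]] := front_ramsey is_tail iX2 (@subs_refl X2).
pose V s := exists t, [/\ front t, {subset t <= s} & t <> s].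
have [X [iX sX hX]] := front_ramsey V iX3 sX3.
have sX' := subs_trans sX sX3.
exists X; split=> //; last first.
  case: h3 => h; [left|right] => s Fs ws; have w3 : within X3 s by move=> x /ws /sX.
    exact: h.
  by case: (Fs) => _ _ _ [/(h s Fs w3)|].
have ex Y : inf Y -> subs Y X -> exists s, [/\ front s, within X s & init s Y].
  move=> iY sY; have [s [u [Fs is1 _ _]]] := front_exists iY (subs_trans sY sX').
  by exists s; split=> // x /(init_mem is1) /sY.
have nV s : front s -> within X s -> ~ V s.
  case: hX => h; last exact: h.
  move=> Fs ws _; have [k sk] : exists k, size s < k by exists (size s).+1.
  elim: k s Fs ws sk => [//|k IH] s Fs ws sk.
  have [t [Ft ts ne]] := h s Fs ws.
  apply: (IH t Ft (fun x xt => ws x (ts x xt))).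
  suff : size t < size s by lia.
  have [so _ _ _ _] := Fs; have [to _ _ _ _] := Ft.
  have ut := sorted_uniq ltn_trans ltnn to.
  rewrite ltn_neqAle uniq_leq_size // andbT; apply/eqP => est; apply: ne.
  by apply: sorted_eq_mem => //; have [] := uniq_min_size ut ts; rewrite ?est.
split.
- by move=> s [[]].
- apply: infinite_family => n.
  have [|s [Fs ws is1]] := ex _ (inf_ge n iX); first by move=> x [].
  by exists s; split=> //; [case: Fs|move=> x /(init_mem is1) []].
- move=> s t [Fs ws] [Ft wt] st; apply: contrapT => ne.
  by apply: (nV t Ft wt); exists s.
- move=> Y iY sY; have [|s [Fs ws is1]] := ex Y iY.
    by move=> x /sY [s [[_ ws] /ws]].
  by exists s; split=> //; [case: Fs|apply: init_init_seg => //; case: Fs].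
Qed.

Lemma const_union X s t : subs X X2 ->
  ((forall s, front s -> within X s -> is_tail s) \/
   (forall s, front s -> within X s -> pre_const s)) ->
  front s -> within X s -> front t -> within X t -> tri s t ->
  exists m u, [/\ m :: t = s ++ u, sorted ltn (m :: t), within X1 (m :: t) & const (m :: t)].
Proof.
move=> sX alt Fs ws Ft wt [r [so [u [u0 er]] et]].
have [_ w2s s0 _ _] := Fs; have [sot w2t t0 _ _] := Ft.
case: s s0 Fs ws w2s er => [//|m s'] _ Fs ws w2s er.
have rE : r = m :: t by rewrite et er.
have w1s : within X1 (m :: s') by move=> x /w2s /sX2.
have w1t : within X1 t by move=> x /w2t /sX2.
have X1m : X1 m by apply: w1s; apply: mem_head.
have wr : within X1 (m :: t) by move=> x; rewrite inE => /orP[/eqP->|/w1t].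
rewrite rE in so er; exists m, u; split=> //.
case: alt => alt.
(* By the choice of [nu], the segment starting with [m] and [m'] is no longer than [nu m' :: t], so
   it is a prefix of [m :: t], and the value is constant from there on. *)
- have [_] := alt t Ft wt.
  case: t t0 {Ft wt rE et} sot w2t w1t so wr er => [//|m' t'] _ sot w2t w1t so wr er /= Ct.
  have [Xn nm' maxn] := nuP (w2t m' (mem_head _ _)).
  have mm' : m < m' by have /= /andP[] := so.
  pose W := above (m :: m' :: t') X1.
  have iW : inf W by apply: inf_above.
  have wn : within X1 (nu m' :: m' :: t').
    by move=> x; rewrite inE => /orP[/eqP->|/w1t].
  have sWn : subs W (above (nu m' :: m' :: t') X1).
    by move=> x [Xx /= /and3P[_ h1 h2]]; split=> //=; rewrite h1 h2 /= andbT; lia.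
  have := maxn m X1m mm' (join t' W) (inf_join _ iW).
  rewrite -!(@join_cat [:: _; _] t' W) /= (segment_join Ct wn iW sWn).
  have -> : subs (join t' W) (above [:: m'] X1) = True.
    apply/propext; split=> // _; apply: (@subs_join_above [:: m'] t') => //.
      by move=> x xt; apply: w1t; rewrite inE xt orbT.
    by move=> x [Xx /= /andP[_ h]].
  move=> /(_ I) /= sz.
  have [|Cq inq] := cP (inf_join (m :: m' :: t') iW).
    by apply: join_base => [x /wr /sX1|x [/sX1]].
  have [v [e|e]] := init_cmp inq (init_above X1 so).
    have wq : within X1 (c (join (m :: m' :: t') W) ++ v) by rewrite -e.
    rewrite e in so *; apply: const_cat => // [|x xv].
      by apply: const_segment => // x xq; apply: wq; rewrite mem_cat xq.
    by apply: wq; rewrite mem_cat xv orbT.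
  case: v e => [|a v] e; last by move: sz; rewrite e /= size_cat /=; lia.
  by rewrite cats0 in e; rewrite -e; apply: const_segment => //; rewrite e.
(* As [m :: t] properly extends [s], it contains [s] followed by one more element, where the value
   is already constant. *)
have [_ pc] := alt _ Fs ws.
case: u u0 er => [//|z u] _ er.
have so' := so; rewrite er in so'; have /sorted_catP[_ _ lt] := so'.
have zt : z \in t.
  by have := mem_cat z (m :: s') (z :: u); rewrite -er !inE eqxx orbT => /orP[/eqP zm|//];
    have := lt m z (mem_head _ _) (mem_head _ _); rewrite zm ltnn.
rewrite er -cat_rcons in so wr *; apply: const_cat => // [|x xu].
  by apply: pc; split; [exact: w2t|apply/allP => y ys; apply: lt ys (mem_head _ _)].
by apply: wr; rewrite mem_cat xu orbT.
Qed.

(** [Z] is chosen so that joined to [s] it gives [m :: t] followed by some [W]. Constancy allows [W]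
    to be replaced by [Y], and the segments after [m :: t] and after [t] are then related by
    [tri]. *)
Lemma const_union_bad s t m u : sorted ltn s -> t <> [::] -> m :: t = s ++ u ->
  sorted ltn (m :: t) -> within X1 (m :: t) -> const (m :: t) ->
  exists Z, [/\ inf Z, subs Z (above s X1) & forall Y, inf Y -> subs Y (above t X1) ->
    ~ leP (f (c (join s Z))) (f (c (join t Y)))].
Proof.
move=> ss t0 er so wr cr; pose W := above (m :: t) X1.
have iW : inf W by apply: inf_above.
exists (join u W); split; first exact: inf_join.
  apply: subs_join_above; rewrite -?er // => x xu; apply: wr.
  by rewrite er mem_cat xu orbT.
move=> Z iZ sZ; rewrite -join_cat -er.
have lt x : x \in t -> m < x.
  by move: so; rewrite /= (path_sortedE ltn_trans) => /andP[/allP h _]; apply: h.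
have ltZ z : Z z -> m < z.
  move=> /sZ [_ /allP h]; have := h (last 0 t) (last_mem t0).
  by have := lt _ (last_mem t0); rewrite /=; lia.
have sZ' : subs Z W.
  by move=> z Zz; have [Xz h] := sZ z Zz; split=> //=; rewrite h ltZ.
rewrite (cr W Z) //.
have wt : within X1 t by move=> x xt; apply: wr; rewrite inE xt orbT.
have sjZ : subs (join t Z) X1 by apply: join_within => // x /sZ [].
have ijZ := inf_join t iZ.
have [Ct it] := cP ijZ (subs_trans sjZ sX1).
have [|Cs is1] := cP (inf_join (m :: t) iZ).
  by apply: join_base => [x /wr /sX1|x /sZ [/sX1]].
apply: bad => //; apply: (barrier_tri (m := m) hC ijZ _ Cs _ Ct it).
  by move=> x [/lt|/ltZ].
by rewrite -join_cons.
Qed.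

(** Each set starts beyond the segment of the previous one, so the values increase, strictly because
    [s] is not constant. Any other value is dominated by a term whose set starts beyond its
    segment. *)
Lemma cofinal_sequence s : sorted ltn s -> within X1 s -> ~ const s ->
  exists x : S_omega leP,
    (forall i, exists Y, [/\ inf Y, subs Y (above s X1) & proj1_sig x i = f (c (join s Y))]) /\
    (forall Y, inf Y -> subs Y (above s X1) ->
       exists i, leP (f (c (join s Y))) (proj1_sig x i)).
Proof.
move=> so ws nc; have [le _] := mono so ws (within_base ws).
have [//|ne] := const_or_far so ws.
pose Y k x := above s X1 x /\ k <= x.
have iY k : inf (Y k) by apply/inf_ge/inf_above.
have sY k : subs (Y k) (above s X1) by move=> x [].
pose nxt k := (maxn k (last 0 (c (join s (Y k))))).+1.
pose e i := iter i nxt 0.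
have nxt_gt k : k < nxt k by rewrite /nxt; lia.
have emono i j : i < j -> nxt (e i) <= e j.
  move=> /subnKC <-; elim: (j - i.+1) => [|k IH]; first by rewrite addn0.
  by rewrite addnS; apply: (leq_trans IH); apply: ltnW; apply: nxt_gt.
have ege i : i <= e i by elim: i => // i IH; apply: leq_ltn_trans IH (nxt_gt _).
have farY i j : i < j -> far c s (Y (e i)) (Y (e j)).
  by move=> /emono ij z [_]; move: ij; rewrite {1}/nxt; lia.
have incr : strict_incr leP (fun i => f (c (join s (Y (e i))))).
  by move=> i j /farY ij; split; [apply: le|apply: ne].
exists (exist _ _ incr); split=> [i|Z iZ sZ] /=.
  by exists (Y (e i)).
exists (last 0 (c (join s Z))).+1; apply: le => // z [_].
by apply: leq_trans (ege _).
Qed.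

(** * The order type of the front *)

Section OrderType.
Variables (A : Type) (lt : A -> A -> Prop) (hA : well_order lt).
Variables (h : seq nat -> nat * A) (I : A -> Prop).
Hypothesis h_incr : forall s t, C s -> C t -> lexlt s t -> mul_omega_lt lt (h s) (h t).
Hypothesis h_I : forall s, I (h s).2.
Hypothesis I_shift : forall b, I b -> exists g : A -> A,
  (forall x, I x -> I (g x) /\ ~ lt (g x) b) /\ increasing_on lt I g.
Hypothesis blocks : forall n, X1 n -> same_block C c (fun s => (h s).1) [:: n] (above [:: n] X1).

Lemma block_lt n s t : X1 n -> C (n :: s) -> C (n :: t) -> within X1 s -> within X1 t ->
  lexlt s t -> lt (h (n :: s)).2 (h (n :: t)).2.
Proof.
move=> Xn Cs Ct ws wt st.
have [k hk] := blocks Xn (erefl _) (sX1 Xn).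
have hE r : C (n :: r) -> within X1 r -> (h (n :: r)).1 = k.
  move=> Cr wr; have so := barrier_sorted hC Cr.
  have wnr : within X1 (n :: r) by move=> x; rewrite inE => /orP[/eqP->|/wr].
  have iW := inf_above (n :: r) iX1.
  rewrite -(segment_join Cr wnr iW (@subs_refl _)) join_cons; apply: hk.
    exact: inf_join.
  exact: (@subs_join_above [:: n] r).
have lx : lexlt (n :: s) (n :: t) by rewrite /= eqxx st orbT.
by case: (h_incr Cs Ct lx) => [|[]//]; rewrite !hE // ltnn.
Qed.

Lemma front_type : type_le front lt.
Proof.
have a0 : A := (h [::]).2.
have Ia0 : exists a, I a by exists (h [::]).2.
(* A front member may stop early; [ext s] completes it to a tail, so that [h] can be evaluated at a
   member of [C]. *)
have /choice[ext extP] s : exists u, front s -> is_tail (s ++ u) /\ within X2 (s ++ u).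
  have [Fs|n] := EM (front s); last by exists [::].
  have [so ws s0 _ _] := Fs.
  have iY := inf_join s (inf_above s iX2).
  have sY : subs (join s (above s X2)) X2 by apply: join_within => // x [].
  have [s' [u [Fs' is' ts' isu']]] := front_exists iY sY.
  have e := front_uniq Fs Fs' (init_above X2 so) is'.
  by exists u => _; rewrite e; split=> // x /(init_mem isu') /sY.
pose val s := (h (nu (head 0 s) :: s ++ ext s)).2.
have valP s : front s -> [/\ C (nu (head 0 s) :: s ++ ext s), within X1 (s ++ ext s),
    X2 (head 0 s) & X1 (nu (head 0 s))].
  move=> Fs; have [[_ Cs] ws] := extP s Fs; have [so w2 s0 _ _] := Fs.
  have X2h : X2 (head 0 s) by case: (s) s0 w2 => // a l _; apply; apply: mem_head.
  split=> //; first by case: (s) s0 Cs.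
    by move=> x /ws /sX2.
  by case: (nuP X2h).
have val_lt s t : front s -> front t -> head 0 s = head 0 t -> lexlt s t -> lt (val s) (val t).
  move=> Fs Ft est st; have [Cs ws _ Xn] := valP s Fs; have [Ct wt _ _] := valP t Ft.
  rewrite /val -est; rewrite -est in Ct; apply: block_lt => //.
  apply: lexlt_cat => // w ew; have w0 := front_prefix Fs Ft ew.
  by move: st; rewrite ew w0 cats0 lexlt_irr.
(* The bound comes from a segment that starts with [nu m] and whose next entry exceeds [m]: it is
   lexicographically later than all those continuing with [m]. *)
have /choice[bd bdP] m : exists a, I a /\ forall s, front s -> head 0 s = m -> lt (val s) a.
  have [X2m|nm] := EM (X2 m); last first.
    case: Ia0 => a Ia; exists a; split=> // s Fs es; case: nm; rewrite -es.
    by case: (valP s Fs).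
  have iY := inf_above [:: m] iX2.
  have sY : subs (above [:: m] X2) X2 by move=> x [].
  have [Xn nm _] := nuP X2m.
  have ltn' y : above [:: m] X2 y -> nu m < y by move=> [_ /= /andP[/ltnW h1 _]]; apply: leq_trans h1.
  have sYb : subs (above [:: m] X2) (base C) by move=> x /sY /sX2 /sX1.
  have [t [et it]] := segment_cons hC cP (sX1 Xn) iY sYb ltn'.
  have [|Ct _] := cP (inf_join [:: nu m] iY).
    by apply: join_base => // x; rewrite inE => /eqP ->; apply: sX1.
  rewrite et in Ct.
  exists (h (nu m :: t)).2; split=> // s Fs es; have [Cs ws _ _] := valP s Fs.
  rewrite /val es in Cs *; apply: block_lt => //.
    by move=> x /(init_mem it) /sY /sX2.
  case: t it et Ct => [_ et Ct|a t it _ _].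
    exfalso; apply: (const_singleton Xn); apply: const_segment => // x.
    by rewrite inE => /eqP ->.
  have [_ _ s0 _ _] := Fs; case: (s) s0 es => //= b l _ ->.
  by have [_ /= /andP[->]] := init_mem it (mem_head _ _).
have /choice[sh shP] b : exists g : A -> A, I b ->
    (forall x, I x -> I (g x) /\ ~ lt (g x) b) /\ increasing_on lt I g.
  have [Ib|n] := EM (I b); last by exists id.
  by have [g hg] := I_shift Ib; exists g.
case: Ia0 => a Ia.
(* Partial sums: the values with head [m] are shifted past [beta m], and their bound [bd m], shifted
   likewise, is [beta m.+1]. *)
pose beta m := iteri m (fun i b => sh b (bd i)) a.
have Ibeta m : I (beta m).
  elim: m => //= m Ib; have [h1 _] := shP _ Ib.
  by case: (h1 (bd m)) => //; case: (bdP m).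
have beta_mono m n : m <= n -> ~ lt (beta n) (beta m).
  move=> /subnKC <-; elim: (n - m) => [|k IH]; first by rewrite addn0; apply: wo_irr.
  rewrite addnS /= => l; apply: IH; have [h1 _] := shP _ (Ibeta (m + k)).
  have [|_ h2] := h1 (bd (m + k)); first by case: (bdP (m + k)).
  by case: (wo_nlt hA h2) => [<-//|h3]; apply: wo_trans l.
exists (fun s => sh (beta (head 0 s)) (val s)) => s t Fs Ft st.
have [_ g1] := shP _ (Ibeta (head 0 s)).
have [est|nst] := eqVneq (head 0 s) (head 0 t).
  by rewrite -est; apply: g1; [exact: h_I|exact: h_I|exact: val_lt].
have hlt : head 0 s < head 0 t.
  have [_ _ s0 _ _] := Fs; have [_ _ t0 _ _] := Ft.
  case: (s) s0 st nst => // x l _; case: (t) t0 => // y l' _ /=.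
  by case: eqP => //= _; rewrite orbF.
have [Ibd lbd] := bdP (head 0 s).
have l1 : lt (sh (beta (head 0 s)) (val s)) (beta (head 0 s).+1).
  by apply: g1; [exact: h_I|by []|exact: lbd].
apply: (wo_lt_le hA l1) => l2.
have [h1 _] := shP _ (Ibeta (head 0 t)).
have [|_ h2] := h1 (val t); first exact: h_I.
by apply: (beta_mono _ _ hlt); case: (wo_nlt hA h2) => [<-//|h3]; apply: (wo_trans hA h3).
Qed.

Theorem sdom_not_bqo : ~ is_bqo lt (@sdom_le P leP).
Proof.
move=> bqo; have [X [iX sX hB alt]] := restricted_front.
have FX s : front s -> [/\ sorted ltn s, within X1 s, s <> [::] & ~ const s].
  by move=> Fs; case: (Fs) => h1 h2 h3 _ _; split=> //;
    [move=> x /h2 /sX2|exact: front_nonconst].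
have wit s : front s -> exists x : S_omega leP,
    (forall i, exists Y, [/\ inf Y, subs Y (above s X1) & proj1_sig x i = f (c (join s Y))]) /\
    (forall Y, inf Y -> subs Y (above s X1) ->
       exists i, leP (f (c (join s Y))) (proj1_sig x i)).
  by move=> /FX [h1 h2 _ h4]; apply: cofinal_sequence.
have [s0 [_ [F0 _ _ _]]] := front_exists iX2 (@subs_refl X2).
have [x0 _] := wit s0 F0.
have /choice[G GP] s : exists x : S_omega leP, front s ->
    (forall i, exists Y, [/\ inf Y, subs Y (above s X1) & proj1_sig x i = f (c (join s Y))]) /\
    (forall Y, inf Y -> subs Y (above s X1) ->
       exists i, leP (f (c (join s Y))) (proj1_sig x i)).
  by have [/wit [x hx]|n] := EM (front s); [exists x|exists x0].
have [|s [t [[Fs ws] [Ft wt] st le]]] := bqo _ hB _ G.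
  by have [g gP] := front_type; exists g => s t [Fs _] [Ft _]; apply: gP.
have [m [u [er so wr cr]]] := const_union sX alt Fs ws Ft wt st.
have [ss _ _ _] := FX s Fs; have [_ _ t0 _] := FX t Ft.
have [Z [iZ sZ hZ]] := const_union_bad ss t0 er so wr cr.
(* The value at [s] with [Z] is below a term of [G s], hence below a term of [G t], which is a value
   at [t]; [hZ] excludes this. *)
have [i li] := (GP s Fs).2 Z iZ sZ.
have [y [[j <-] lj]] := le (proj1_sig (G s) i) (ex_intro _ i (erefl _)).
have [Y [iY sY eY]] := (GP t Ft).1 j.
by apply: (hZ Y iY sY); rewrite -eY; apply: leP_trans li lj.
Qed.

End OrderType.
End Descent.

(** * Assembling the equivalences *)

Lemma sdom_mul_bqo (A : Type) (ltA : A -> A -> Prop) (P : Type) (leP : P -> P -> Prop) :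
  inhabited A -> well_order ltA -> (forall x y z, leP x y -> leP y z -> leP x z) ->
  is_bqo omega_lt leP -> is_bqo ltA (@sdom_le P leP) -> is_bqo (mul_omega_lt ltA) leP.
Proof.
move=> inhA hA leP_trans wqo sbqo C hC [h0 h0P] f; apply: contrapT => ngood.
have bad s t : C s -> C t -> tri s t -> ~ leP (f s) (f t).
  by move=> Cs Ct st le; apply: ngood; exists s, t.
(* Blocks are taken in the indecomposable [I], where a sum of bounded pieces over all heads still
   fits. *)
have [I [phi [_ phiI phi_lt shift]]] := indecomposable_segment hA inhA.
pose h s := phi (h0 s).
have h_lt s t : C s -> C t -> lexlt s t -> mul_omega_lt ltA (h s) (h t).
  by move=> Cs Ct st; apply/phi_lt/h0P.
have h1_le s t : C s -> C t -> lexlt s t -> (h s).1 <= (h t).1.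
  by move=> Cs Ct st; case: (h_lt s t Cs Ct st) => [/ltnW|[->]].
have [c cP] := segment_exists hC.
have [X1 [iX1 sX1 hX1]] := diagonal (barrier_base_inf hC)
  (hereditary_and (@monotone_at_hereditary C c P f leP)
    (hereditary_and (@same_block_hereditary C c (fun s => (h s).1))
      (@comparable_at_hereditary C c)))
  (dense_and (@monotone_at_hereditary C c P f leP) (monotone_at_dense hC cP f wqo)
    (dense_and (@same_block_hereditary C c (fun s => (h s).1))
      (same_block_dense hC cP h1_le) (comparable_at_dense hC cP))).
have mono s : sorted ltn s -> within X1 s -> monotone_at C c f leP s (above s X1).
  by move=> so ws; case: (hX1 s so ws).
have blocks n : X1 n -> same_block C c (fun s => (h s).1) [:: n] (above [:: n] X1).
  by move=> Xn; case: (hX1 [:: n]) => // [x|_ []//]; rewrite inE => /eqP ->.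
have [X3 [iX3 sX3 unif3]] := uniform_exists c f iX1.
have [x1 [Xx1 _]] := inf_min iX1.
(* Keeping beyond [x1] guarantees every [m] in [X2] a smaller element of [X1], from which [nu m] is
   chosen. *)
pose X2 := above [:: x1] X3.
have s23 : subs X2 X3 by move=> x [].
have sX2 := subs_trans s23 sX3.
have unif s : sorted ltn s -> within X2 s -> uniform_at c f X1 s (above s X2).
  move=> so ws; have sab : subs (above s X2) (above s X3) by apply: above_subs.
  by case: (unif3 s so) => [x /ws /s23//|k|k]; [left|right] => m /sab /k.
pose better m n' n := forall Y, inf Y -> subs Y (above [:: m] X1) ->
  size (c (join [:: n'; m] Y)) <= size (c (join [:: n; m] Y)).
have cmp m n n' : X1 m -> X1 n -> X1 n' -> n < n' -> n' < m -> better m n n' \/ better m n' n.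
  move=> Xm Xn Xn' nn' n'm; have ws : within X1 [:: n; n'; m].
    by move=> x; rewrite !inE => /or3P[] /eqP ->.
  have [|_ [_ cm]] := hX1 [:: n; n'; m] _ ws; first by rewrite /= nn' n'm.
  have eab : above [:: n; n'; m] X1 = above [:: m] X1.
    by apply: setext => x; split=> -[Xx /= h']; split=> //=; lia.
  by rewrite eab in cm; apply: cm (erefl _) _ => x /ws /sX1.
have /choice[nu nuP] m : exists n, X2 m -> [/\ X1 n, n < m &
    forall n', X1 n' -> n' < m -> better m n' n].
  have [X2m|no] := EM (X2 m); last by exists 0.
  have [|||n [nm Xn hn]] := @finite_max X1 (better m) m.
  - move=> n n' Xn Xn' nm n'm; have Xm := sX2 m X2m.
    case: (ltngtP n n') => [nn'|n'n|->]; [exact: cmp|by case: (cmp m n' n); tauto|].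
    by left.
  - by move=> n1 n2 n3 h12 h23 Y iY sY; apply: leq_trans (h12 Y iY sY) (h23 Y iY sY).
  - by exists x1; split=> //; case: X2m => _ /= /andP[].
  by exists n => _; split=> // n' Xn' n'm; apply: hn.
exact: (sdom_not_bqo hC cP leP_trans bad iX1 sX1 mono (inf_above _ iX3) sX2 unif nuP
  hA h_lt (fun s => phiI (h0 s)) shift blocks) sbqo.
Qed.

Theorem theorem2p16 (A : Type) (ltA : A -> A -> Prop) (P : Type) (leP : P -> P -> Prop) :
  countable_ordinal ltA ->
  (* alpha >= omega *)
  (exists e : nat -> A, forall m n, (m < n)%N -> ltA (e m) (e n)) ->
  poset leP ->
  [<-> is_bqo (mul_omega_lt ltA) leP;
       is_bqo omega_lt leP /\ is_bqo ltA (@sdom_le P leP);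
       is_bqo ltA (@cdom_le P leP);
       is_bqo ltA (@dom_le P leP)].
Proof.
move=> [hA _] omA [_ _ leP_trans].
have inhA : inhabited A by case: omA => e _; exists; apply: e 0.
have mul_cdom : is_bqo (mul_omega_lt ltA) leP -> is_bqo ltA (@cdom_le P leP).
  by move=> /bqo_dom /dom_cdom_bqo.
have cdom_sdom : is_bqo ltA (@cdom_le P leP) ->
    is_bqo omega_lt leP /\ is_bqo ltA (@sdom_le P leP).
  by move=> h; split; [exact: cdom_omega_bqo h|exact: cdom_sdom_bqo].
have sdom_mul : is_bqo omega_lt leP /\ is_bqo ltA (@sdom_le P leP) ->
    is_bqo (mul_omega_lt ltA) leP.
  by case=> h1 h2; apply: sdom_mul_bqo.
(* The cycle proved is (i), (iv), (iii), (ii), (i); the implications in the listed order are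
   composed along it. *)
tfae.
- by move=> /mul_cdom /cdom_sdom.
- by move=> /sdom_mul /mul_cdom.
- by move=> /cdom_sdom /sdom_mul /bqo_dom.
- by move=> /dom_cdom_bqo /cdom_sdom /sdom_mul.
Qed.
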